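(* There exists a low${}_2$ Turing degree bounding $\mathsf{EM}$; that is, there is a set $G$ with $G''\leq_T\emptyset''$ such that every computable infinite tournament has a $G$-computable infinite transitive subtournament.
   Context: A tournament $T$ on an infinite domain $D\subseteq\mathbb N$ is an irreflexive binary relation on $D$ with exactly one of $T(x,y)$, $T(y,x)$ for all distinct $x,y\in D$; a subset is transitive if $T$ restricted to it is transitive. $\mathsf{EM}$: every infinite tournament has an infinite transitive subtournament. *)

(* Defs.v *)
From Stdlib Require Import Arith List Cantor.
Import ListNotations.

Inductive code : Type :=
| CZero
| CSucc
| CProj (i : nat)
| COracle
| CComp (f : code) (gs : list code)
| CPrimRec (f g : code)
| CMu (f : code).

Fixpoint eval (k : nat) (X : nat -> bool) (c : code) (xs : list nat)
  : option nat :=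
  match k with
  | 0 => None
  | S k =>
    match c with
    | CZero => Some 0
    | CSucc => Some (S (hd 0 xs))
    | CProj i => Some (nth i xs 0)
    | COracle => Some (if X (hd 0 xs) then 1 else 0)
    | CComp f gs =>
        let fix evals (gs : list code) : option (list nat) :=
          match gs with
          | nil => Some nil
          | g :: gs' =>
              match eval k X g xs, evals gs' with
              | Some y, Some ys => Some (y :: ys)
              | _, _ => None
              end
          end in
        match evals gs with
        | Some ys => eval k X f ys
        | None => None
        end
    | CPrimRec f g =>
        let ys := tl xs in
        let fix pr (n : nat) : option nat :=
          match n with
          | 0 => eval k X f ys
          | S m =>
              match pr m with
              | Some r => eval k X g (m :: r :: ys)
              | None => None
              end
          end in
        pr (hd 0 xs)
    | CMu f =>
        let fix search (j n : nat) : option nat :=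
          match j with
          | 0 => None
          | S j' =>
              match eval k X f (n :: xs) with
              | Some 0 => Some n
              | Some (S _) => search j' (S n)
              | None => None
              end
          end in
        search k 0
    end
  end.

(* Goedel numbering: decoding naturals into programs (fuel = n suffices,
   since Cantor-unpairing and division by 7 decrease). *)
Fixpoint decode_aux (fuel n : nat) : code :=
  match fuel with
  | 0 => CZero
  | S fuel =>
    let r := n / 7 in
    match n mod 7 with
    | 0 => CZero
    | 1 => CSucc
    | 2 => CProj r
    | 3 => COracle
    | 4 =>
        let (a, b) := of_nat r in
        let fix dlist (fl m : nat) : list code :=
          match fl with
          | 0 => nil
          | S fl' =>
            match m with
            | 0 => nil
            | S m' => let (a', c') := of_nat m' in
                      decode_aux fuel a' :: dlist fl' c'
            end
          end in
        CComp (decode_aux fuel a) (dlist (S b) b)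
    | 5 => let (a, b) := of_nat r in CPrimRec (decode_aux fuel a) (decode_aux fuel b)
    | _ => CMu (decode_aux fuel r)
    end
  end.

Definition decode (n : nat) : code := decode_aux (S n) n.

Definition is_char (f : nat -> bool) (A : nat -> Prop) : Prop :=
  forall n, f n = true <-> A n.

Definition halts (X : nat -> bool) (e n : nat) : Prop :=
  exists k v, eval k X (decode e) [n] = Some v.

Definition Turing_red (A B : nat -> Prop) : Prop :=
  exists e : nat, forall f : nat -> bool, is_char f B ->
    forall n, exists k,
      (eval k f (decode e) [n] = Some 1 /\ A n) \/
      (eval k f (decode e) [n] = Some 0 /\ ~ A n).

Definition jump (X : nat -> Prop) : nat -> Prop :=
  fun e => exists f : nat -> bool, is_char f X /\ halts f e e.

Definition empty_set : nat -> Prop := fun _ => False.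

Definition computable (A : nat -> Prop) : Prop := Turing_red A empty_set.

Definition computable2 (R : nat -> nat -> Prop) : Prop :=
  exists e : nat, forall x y, exists k,
    (eval k (fun _ => false) (decode e) [x; y] = Some 1 /\ R x y) \/
    (eval k (fun _ => false) (decode e) [x; y] = Some 0 /\ ~ R x y).

Definition infinite (A : nat -> Prop) : Prop :=
  forall n, exists m, n <= m /\ A m.

Definition tournament (D : nat -> Prop) (T : nat -> nat -> Prop) : Prop :=
  (forall x y, T x y -> D x /\ D y) /\
  (forall x, ~ T x x) /\
  (forall x y, D x -> D y -> x <> y -> (T x y \/ T y x) /\ ~ (T x y /\ T y x)).

Definition transitive_subset (D : nat -> Prop) (T : nat -> nat -> Prop)
  (H : nat -> Prop) : Prop :=
  (forall x, H x -> D x) /\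
  (forall x y z, H x -> H y -> H z -> T x y -> T y z -> T x z).

(* Main.v *)
(** A condition is a finite string F (an initial segment of G) with an infinite reservoir.  Given
    the k-th requirement on G', ask whether every k-tuple of 2-colorings of the reservoir (a guess,
    for each of the first k tournaments, at the direction of the edges from x to almost all later
    elements) admits a finite extension of F inside the reservoir that is transitive for these
    tournaments, consistent with the guess, and meets the requirement.  If so, apply this to the
    true limit directions; transitivity survives because the extension agrees with the limits.
    If not, thin the reservoir to an infinite set on which a bad coloring is constant: there every
    transitive set is consistent with the coloring, so G fails the requirement.  One G serves
    all tournaments because the i-th tournament only matters from stage i+1 on, and partial
    tournaments are made total by delaying their vertices.

    For the complexity bound, take by the low basis theorem a low L whose columns are all the edge
    sets {y | x -> y} and, for every condition, a bad coloring if there is one.  Then use the low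
    basis theorem relative to L' to get a type p over the columns of L (a choice of sides with
    infinite finite intersections; this is a Pi^0_1(L') class) with (p + L')' <= L''.  The
    construction is recursive in p + L', so G'' <= (p + L')' <= L'' <= 0''. *)

From Stdlib Require Import Arith List Cantor Lia Bool.
From Stdlib Require Import Classical ClassicalEpsilon FunctionalExtensionality.
Require Import Defs.
Import ListNotations.

(** * Programs *)

(** The limit directions are known only through the type. A question that mentions them would be
    Sigma^0_1 in the oracle of the construction, so answering it would cost one jump too many.
    Quantifying over all colorings removes the type from the question. The coloring attached to a
    condition is chosen so that a hit for it entails hits for all colorings, which leaves a single
    Sigma^0_1(L) question that L' decides.

    That L contains colorings for conditions referring to L is not circular: the reservoir of a
    condition [h] consults only columns below [h], while its coloring is stored in the columns
    [(2h+1, i)], which are larger.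

    Only the first jump of G is forced directly. Since G' is computed by an oracle whose own jump
    lies below L'', the second jump needs no requirements.

    Lowness and the final reductions are statements about the given programs, so every finite
    question above has to be decided by such a program. This is why [eval] is arithmetised:
    computations become coded derivations with a bound on their oracle use. *)

Fixpoint code_nested_ind (P : code -> Prop)
  (HZ : P CZero) (HS : P CSucc) (HP : forall i, P (CProj i)) (HO : P COracle)
  (HC : forall f gs, P f -> Forall P gs -> P (CComp f gs))
  (HR : forall f g, P f -> P g -> P (CPrimRec f g))
  (HM : forall f, P f -> P (CMu f)) (c : code) : P c :=
  let ind := code_nested_ind P HZ HS HP HO HC HR HM in
  match c with
  | CZero => HZ
  | CSucc => HS
  | CProj i => HP i
  | COracle => HO
  | CComp f gs => HC f gs (ind f)
      ((fix go l : Forall P l :=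
          match l with
          | nil => Forall_nil P
          | g :: l' => Forall_cons g (ind g) (go l')
          end) gs)
  | CPrimRec f g => HR f g (ind f) (ind g)
  | CMu f => HM f (ind f)
  end.

Lemma eval_comp_iff k X f gs xs v :
  eval (S k) X (CComp f gs) xs = Some v <->
  exists ys, Forall2 (fun g y => eval k X g xs = Some y) gs ys /\
    eval k X f ys = Some v.
Proof.
  simpl.
  set (es := fix evals (gs : list code) : option (list nat) := _).
  assert (H : forall gs ys, es gs = Some ys <->
            Forall2 (fun g y => eval k X g xs = Some y) gs ys).
  { clear gs. induction gs as [|g gs IH]; intros ys; simpl.
    - split; [intros [= <-]; constructor | inversion 1; reflexivity].
    - split.
      + destruct (eval k X g xs) eqn:Hg; [|discriminate].
        destruct (es gs) eqn:Hgs; [|discriminate].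
        intros [= <-]. constructor; [assumption | now apply IH].
      + inversion 1; subst.
        match goal with H : Forall2 _ gs _ |- _ => apply IH in H; rewrite H end.
        match goal with H : eval k X g xs = _ |- _ => now rewrite H end. }
  split.
  - destruct (es gs) as [ys|] eqn:Hy; [|discriminate].
    intros Hv. exists ys. split; [now apply H | assumption].
  - intros (ys & Hy & Hv). apply H in Hy. now rewrite Hy.
Qed.

(** [R] is the trace of the recursion; quantifying over it replaces the local fixpoint once and for
    all. *)
Lemma eval_primrec_iff k X f g xs v :
  eval (S k) X (CPrimRec f g) xs = Some v <->
  exists R, eval k X f (tl xs) = Some (R 0) /\
    (forall m, m < hd 0 xs ->
       eval k X g (m :: R m :: tl xs) = Some (R (S m))) /\
    v = R (hd 0 xs).
Proof.
  simpl.
  set (pr := fix pr (n : nat) : option nat := _).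
  generalize (hd 0 xs) as n. intros n. revert v. induction n as [|n IH]; intros v.
  - simpl. split.
    + intros Hv. exists (fun _ => v). repeat split; auto; lia.
    + intros (R & H0 & _ & ->). assumption.
  - split.
    + simpl. destruct (pr n) as [r|] eqn:Hr; [|discriminate].
      intros Hv. destruct (proj1 (IH r) eq_refl) as (R & H0 & HR & ->).
      exists (fun m => if m <=? n then R m else v).
      repeat split.
      * exact H0.
      * intros m Hm. replace (m <=? n) with true by (symmetry; apply Nat.leb_le; lia).
        destruct (S m <=? n) eqn:Hle.
        -- apply HR. apply Nat.leb_le in Hle. lia.
        -- apply Nat.leb_gt in Hle. replace m with n by lia. exact Hv.
      * replace (S n <=? n) with false by (symmetry; apply Nat.leb_gt; lia).
        reflexivity.
    + intros (R & H0 & HR & ->). simpl.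
      rewrite (proj2 (IH (R n))); [apply HR; lia|].
      exists R. repeat split; auto.
Qed.

Lemma eval_mu_iff k X f xs v :
  eval (S k) X (CMu f) xs = Some v <->
  v < k /\ eval k X f (v :: xs) = Some 0 /\
  forall n, n < v -> exists u, eval k X f (n :: xs) = Some (S u).
Proof.
  simpl.
  set (se := fix search (j n : nat) : option nat := _).
  assert (H : forall j n, se j n = Some v <->
    n <= v /\ v < n + j /\ eval k X f (v :: xs) = Some 0 /\
    forall i, n <= i -> i < v -> exists u, eval k X f (i :: xs) = Some (S u)).
  { induction j as [|j IH]; intros n; simpl.
    - split; [discriminate | lia].
    - destruct (eval k X f (n :: xs)) as [[|u]|] eqn:Hn.
      + split.
        * intros [= <-]. repeat split; try lia. assumption.
        * intros (H1 & H2 & H3 & H4). f_equal.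
          destruct (Nat.eq_dec n v) as [|Hne]; [assumption|].
          destruct (H4 n) as [u Hu]; [lia..|]. congruence.
      + rewrite IH. split.
        * intros (H1 & H2 & H3 & H4). repeat split; try lia; try assumption.
          intros i Hi Hv. destruct (Nat.eq_dec n i) as [->|Hne]; [eauto|].
          apply H4; lia.
        * intros (H1 & H2 & H3 & H4).
          assert (n <> v) by congruence.
          repeat split; try lia; try assumption.
          intros i Hi Hv. apply H4; lia.
      + split; [discriminate|]. intros (H1 & H2 & H3 & H4).
        destruct (Nat.eq_dec n v) as [->|Hne]; [congruence|].
        destruct (H4 n) as [u Hu]; [lia..|]. congruence. }
  rewrite H. split.
  - intros (_ & H2 & H3 & H4). repeat split; try lia; try assumption.
    intros n Hn. apply H4; lia.
  - intros (H2 & H3 & H4). repeat split; try lia; try assumption.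
    intros n _ Hn. apply H4; lia.
Qed.

Lemma eval_mono X k : forall k' c xs v, k <= k' ->
  eval k X c xs = Some v -> eval k' X c xs = Some v.
Proof.
  induction k as [|k IH]; intros k' c xs v Hk H; [discriminate|].
  destruct k' as [|k']; [lia|].
  assert (Hk' : k <= k') by lia.
  destruct c; try exact H.
  - apply eval_comp_iff in H. destruct H as (ys & Hy & Hv).
    apply eval_comp_iff. exists ys. split; [|eauto].
    eapply Forall2_impl; [|exact Hy]. intros; simpl in *; eauto.
  - apply eval_primrec_iff in H. destruct H as (R & H0 & HR & ->).
    apply eval_primrec_iff. exists R. repeat split; eauto.
  - apply eval_mu_iff in H. destruct H as (Hv & H0 & Hn).
    apply eval_mu_iff. repeat split; [lia|eauto|].
    intros n Hlt. destruct (Hn n Hlt) as [u Hu]. exists u. eauto.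
Qed.

Definition evals_to (X : nat -> bool) (c : code) (xs : list nat) (v : nat) : Prop :=
  exists k, eval k X c xs = Some v.

Lemma evals_to_fun X c xs v w :
  evals_to X c xs v -> evals_to X c xs w -> v = w.
Proof.
  intros [k Hk] [k' Hk'].
  apply (eval_mono X k (k + k')) in Hk; [|lia].
  apply (eval_mono X k' (k + k')) in Hk'; [|lia]. congruence.
Qed.

Lemma evals_to_comp X f gs xs ys v :
  Forall2 (fun g y => evals_to X g xs y) gs ys ->
  evals_to X f ys v -> evals_to X (CComp f gs) xs v.
Proof.
  intros Hg [k Hk].
  assert (H : exists k', Forall2 (fun g y => eval k' X g xs = Some y) gs ys).
  { clear Hk. induction Hg as [|g y gs ys [k1 H1] _ [k2 H2]].
    - exists 0. constructor.
    - exists (k1 + k2). constructor.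
      + eapply eval_mono; [|exact H1]. lia.
      + eapply Forall2_impl; [|exact H2]. intros a b Hab.
        eapply eval_mono; [|exact Hab]. lia. }
  destruct H as [k' H]. exists (S (k + k')). apply eval_comp_iff.
  exists ys. split.
  - eapply Forall2_impl; [|exact H]. intros a b Hab.
    eapply eval_mono; [|exact Hab]. lia.
  - eapply eval_mono; [|exact Hk]. lia.
Qed.

Lemma evals_to_primrec X f g xs (R : nat -> nat) :
  evals_to X f (tl xs) (R 0) ->
  (forall m, m < hd 0 xs -> evals_to X g (m :: R m :: tl xs) (R (S m))) ->
  evals_to X (CPrimRec f g) xs (R (hd 0 xs)).
Proof.
  intros [k0 H0] HR.
  assert (H : exists k, forall m, m < hd 0 xs ->
            eval k X g (m :: R m :: tl xs) = Some (R (S m))).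
  { revert HR. generalize (hd 0 xs). induction n as [|n IH]; intros HR.
    - exists 0. lia.
    - destruct IH as [k1 H1]; [intros; apply HR; lia|].
      destruct (HR n) as [k2 H2]; [lia|].
      exists (k1 + k2). intros m Hm.
      destruct (Nat.eq_dec m n) as [->|].
      + eapply eval_mono; [|exact H2]. lia.
      + eapply eval_mono; [|apply H1]; lia. }
  destruct H as [k H]. exists (S (k0 + k)). apply eval_primrec_iff.
  exists R. repeat split.
  - eapply eval_mono; [|exact H0]. lia.
  - intros m Hm. eapply eval_mono; [|apply H; exact Hm]. lia.
Qed.

Lemma evals_to_mu X f xs v :
  evals_to X f (v :: xs) 0 ->
  (forall n, n < v -> exists u, evals_to X f (n :: xs) (S u)) ->
  evals_to X (CMu f) xs v.
Proof.
  intros [k0 H0] Hn.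
  assert (H : exists k, forall n, n < v -> exists u, eval k X f (n :: xs) = Some (S u)).
  { clear H0. induction v as [|v IH].
    - exists 0. lia.
    - destruct IH as [k1 H1]; [intros; apply Hn; lia|].
      destruct (Hn v) as (u & k2 & H2); [lia|].
      exists (k1 + k2). intros m Hm.
      destruct (Nat.eq_dec m v) as [->|].
      + exists u. eapply eval_mono; [|exact H2]. lia.
      + destruct (H1 m) as [u' Hu']; [lia|].
        exists u'. eapply eval_mono; [|exact Hu']. lia. }
  destruct H as [k H]. exists (S (k0 + k + S v)). apply eval_mu_iff.
  repeat split; [lia| |].
  - eapply eval_mono; [|exact H0]. lia.
  - intros n Hlt. destruct (H n Hlt) as [u Hu].
    exists u. eapply eval_mono; [|exact Hu]. lia.
Qed.

Lemma nth_0_hd (xs : list nat) : nth 0 xs 0 = hd 0 xs.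
Proof. now destruct xs. Qed.

Lemma nth_tl (xs : list nat) i : nth i (tl xs) 0 = nth (S i) xs 0.
Proof. destruct xs, i; reflexivity. Qed.

(** Argument lists have no fixed length and missing entries read as 0, so comparing entries with
    default 0 up to [N] suffices and no notion of arity is needed. *)
Lemma eval_finite_dependence X c : exists N, forall xs ys,
  (forall i, i < N -> nth i xs 0 = nth i ys 0) ->
  forall k v, eval k X c xs = Some v -> eval k X c ys = Some v.
Proof.
  induction c as [| |i| |f gs IHf IHgs|f g IHf IHg|f IHf] using code_nested_ind.
  - exists 0. intros xs ys _ [|k] v; auto.
  - exists 1. intros xs ys H [|k] v; [discriminate|]. simpl.
    assert (H0 := H 0 Nat.lt_0_1). rewrite !nth_0_hd in H0. now rewrite H0.
  - exists (S i). intros xs ys H [|k] v; [discriminate|]. simpl.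
    now rewrite (H i (Nat.lt_succ_diag_r i)).
  - exists 1. intros xs ys H [|k] v; [discriminate|]. simpl.
    assert (H0 := H 0 Nat.lt_0_1). rewrite !nth_0_hd in H0. now rewrite H0.
  - assert (HN : exists N, forall xs ys,
      (forall i, i < N -> nth i xs 0 = nth i ys 0) ->
      forall k zs, Forall2 (fun g y => eval k X g xs = Some y) gs zs ->
                   Forall2 (fun g y => eval k X g ys = Some y) gs zs).
    { clear IHf. induction IHgs as [|g gs [N1 H1] _ [N2 H2]].
      - exists 0. intros xs ys _ k zs Hz. inversion Hz. constructor.
      - exists (N1 + N2). intros xs ys H k zs Hz. inversion Hz; subst.
        constructor.
        + eapply H1; [|eassumption]. intros; apply H; lia.
        + eapply H2; [|eassumption]. intros; apply H; lia. }
    destruct HN as [N HN]. exists N. intros xs ys H [|k] v; [discriminate|].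
    rewrite !eval_comp_iff. intros (zs & Hz & Hv). exists zs. split; [|assumption].
    eapply HN; eauto.
  - destruct IHf as [N IHf], IHg as [M IHg].
    exists (S (N + M)). intros xs ys H [|k] v; [discriminate|].
    rewrite !eval_primrec_iff. intros (R & H0 & HR & ->). exists R.
    assert (Hh : hd 0 ys = hd 0 xs) by
      (rewrite <- !nth_0_hd; symmetry; apply H; lia).
    rewrite Hh. repeat split.
    + eapply IHf; [|exact H0]. intros i Hi. rewrite !nth_tl. apply H. lia.
    + intros m Hm. eapply IHg; [|apply HR, Hm].
      intros [|[|i]] Hi; simpl; auto. rewrite !nth_tl. apply H. lia.
  - destruct IHf as [N IHf].
    exists N. intros xs ys H [|k] v; [discriminate|].
    rewrite !eval_mu_iff.
    assert (Hc : forall n i, i < N -> nth i (n :: xs) 0 = nth i (n :: ys) 0).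
    { intros n [|i] Hi; simpl; auto. apply H. lia. }
    intros (Hv & H0 & Hn). repeat split; [assumption| |].
    + eapply IHf; [|exact H0]. apply Hc.
    + intros n Hlt. destruct (Hn n Hlt) as [u Hu]. exists u.
      eapply IHf; [|exact Hu]. apply Hc.
Qed.

(** An oracle query looks only at the head of its arguments. [CProj 0] cuts the list down to that
    head, because [d] is assumed correct on one-element lists only. *)
Fixpoint oracle_subst (d c : code) : code :=
  match c with
  | CZero => CZero
  | CSucc => CSucc
  | CProj i => CProj i
  | COracle => CComp d [CProj 0]
  | CComp f gs => CComp (oracle_subst d f) (map (oracle_subst d) gs)
  | CPrimRec f g => CPrimRec (oracle_subst d f) (oracle_subst d g)
  | CMu f => CMu (oracle_subst d f)
  end.

Lemma evals_to_oracle_subst (X Y : nat -> bool) d :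
  (forall n, evals_to Y d [n] (if X n then 1 else 0)) ->
  forall k c xs v, eval k X c xs = Some v -> evals_to Y (oracle_subst d c) xs v.
Proof.
  intros Hd. induction k as [|k IH]; intros c xs v H; [discriminate|].
  destruct c.
  - exists 1. exact H.
  - exists 1. exact H.
  - exists 1. exact H.
  - simpl in *. injection H as <-.
    apply evals_to_comp with [hd 0 xs]; [|apply Hd].
    constructor; [|constructor]. exists 1. simpl. f_equal. apply nth_0_hd.
  - apply eval_comp_iff in H. destruct H as (ys & Hy & Hv). simpl.
    apply evals_to_comp with ys; [|eauto].
    clear Hv. induction Hy; constructor; eauto.
  - apply eval_primrec_iff in H. destruct H as (R & H0 & HR & ->). simpl.
    apply evals_to_primrec; eauto.
  - apply eval_mu_iff in H. destruct H as (_ & H0 & Hn). simpl.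
    apply evals_to_mu; [eauto|]. intros n Hlt.
    destruct (Hn n Hlt) as [u Hu]. eauto.
Qed.

(** * Recursive functions and decidable predicates *)

(** Functions take the whole argument list: variable [i] is [nth i v 0], and a binder conses its
    variable onto the list, so that the parameters become [tl v]. *)
Definition rec (X : nat -> bool) (f : list nat -> nat) : Prop :=
  exists c, forall v, evals_to X c v (f v).

(** Truth is the value 0, the one [CMu] searches for; conjunction becomes addition and disjunction
    multiplication. *)
Definition dec (X : nat -> bool) (P : list nat -> Prop) : Prop :=
  exists f, rec X f /\ forall v, P v <-> f v = 0.

Lemma rec_ext X f g : (forall v, f v = g v) -> rec X f -> rec X g.
Proof. intros H [c Hc]. exists c. intros v. rewrite <- H. apply Hc. Qed.

Lemma dec_ext X (P Q : list nat -> Prop) :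
  (forall v, P v <-> Q v) -> dec X P -> dec X Q.
Proof.
  intros H (f & Hf & HP). exists f. split; [assumption|].
  intros v. rewrite <- H. apply HP.
Qed.

Lemma rec_nth X i : rec X (fun v => nth i v 0).
Proof. exists (CProj i). intros v. exists 1. reflexivity. Qed.

Lemma rec_comp1 X c g (h : nat -> nat) :
  (forall n, evals_to X c [n] (h n)) -> rec X g -> rec X (fun v => h (g v)).
Proof.
  intros Hc [d Hd]. exists (CComp c [d]). intros v.
  apply evals_to_comp with [g v]; auto.
Qed.

Lemma rec_S X f : rec X f -> rec X (fun v => S (f v)).
Proof. apply (rec_comp1 X CSucc). intros n. exists 1. reflexivity. Qed.

Lemma rec_oracle X f : rec X f -> rec X (fun v => if X (f v) then 1 else 0).
Proof.
  apply (rec_comp1 X COracle f (fun n => if X n then 1 else 0)).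
  intros n. exists 1. reflexivity.
Qed.

Lemma rec_const X n : rec X (fun _ => n).
Proof.
  induction n as [|n IH].
  - exists CZero. intros v. exists 1. reflexivity.
  - now apply rec_S in IH.
Qed.

(* A code inspects only finitely many arguments, so finitely many components of [t] suffice. *)
Lemma rec_subst X f (t : list nat -> list nat) :
  rec X f -> (forall i, rec X (fun v => nth i (t v) 0)) ->
  rec X (fun v => f (t v)).
Proof.
  intros [c Hc] Ht.
  destruct (eval_finite_dependence X c) as [N HN].
  assert (Hgs : forall m, exists gs, forall v, Forall2 (fun g y => evals_to X g v y) gs
             (map (fun i => nth i (t v) 0) (seq 0 m))).
  { induction m as [|m [gs Hgs]].
    - exists []. constructor.
    - destruct (Ht m) as [d Hd]. exists (gs ++ [d]). intros v.
      rewrite seq_S, map_app. apply Forall2_app; [apply Hgs|].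
      constructor; [apply Hd | constructor]. }
  destruct (Hgs N) as [gs Hg]. exists (CComp c gs). intros v.
  eapply evals_to_comp; [apply Hg|].
  destruct (Hc (t v)) as [k Hk]. exists k.
  eapply HN; [|exact Hk]. intros i Hi. symmetry.
  rewrite nth_indep with (d' := nth 0 (t v) 0) by
    (rewrite length_map, length_seq; exact Hi).
  rewrite map_nth with (f := fun i => nth i (t v) 0) (d := 0).
  now rewrite seq_nth.
Qed.

Lemma dec_subst X P (t : list nat -> list nat) :
  dec X P -> (forall i, rec X (fun v => nth i (t v) 0)) ->
  dec X (fun v => P (t v)).
Proof.
  intros (f & Hf & HP) Ht. exists (fun v => f (t v)).
  split; [now apply rec_subst | auto].
Qed.

Lemma rec_nth_tl X i (t : list nat -> list nat) :
  rec X (fun v => nth (S i) (t v) 0) -> rec X (fun v => nth i (tl (t v)) 0).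
Proof. apply rec_ext. intros v. symmetry. apply nth_tl. Qed.

Ltac rvar := cbv beta; repeat (apply rec_nth_tl; cbv beta); apply rec_nth.

Lemma rec_tl X f : rec X f -> rec X (fun v => f (tl v)).
Proof. intros H. apply (rec_subst X f (fun v => tl v)); [exact H | intros i; rvar]. Qed.

Lemma rec_nat_rect X f n (G : list nat -> nat -> nat -> nat) :
  rec X f -> rec X n ->
  rec X (fun w => G (tl (tl w)) (nth 0 w 0) (nth 1 w 0)) ->
  rec X (fun v => nat_rect (fun _ => nat) (f v) (G v) (n v)).
Proof.
  intros [c Hc] Hn [d Hd].
  apply (rec_subst X (fun w => nat_rect (fun _ => nat) (f (tl w)) (G (tl w)) (hd 0 w))
           (fun v => n v :: v)).
  - exists (CPrimRec c d). intros w.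
    apply (evals_to_primrec X c d w (nat_rect (fun _ => nat) (f (tl w)) (G (tl w)))).
    + apply Hc.
    + intros m _. simpl.
      apply (Hd (m :: nat_rect (fun _ => nat) (f (tl w)) (G (tl w)) m :: tl w)).
  - intros [|i]; simpl; [exact Hn | apply rec_nth].
Qed.

Lemma rec_least X (P : nat -> list nat -> Prop) g :
  dec X (fun w => P (nth 0 w 0) (tl w)) ->
  (forall v, P (g v) v /\ forall n, n < g v -> ~ P n v) -> rec X g.
Proof.
  intros (f & [c Hc] & HP) Hg. exists (CMu c). intros v.
  destruct (Hg v) as [H0 Hn]. apply evals_to_mu.
  - apply (HP (g v :: v)) in H0. rewrite <- H0. apply Hc.
  - intros n Hlt. exists (pred (f (n :: v))).
    rewrite Nat.succ_pred; [apply Hc|].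
    intros H. apply (HP (n :: v)) in H. exact (Hn n Hlt H).
Qed.

Lemma rec_add X f g : rec X f -> rec X g -> rec X (fun v => f v + g v).
Proof.
  intros Hf Hg.
  apply rec_ext with (fun v => nat_rect (fun _ => nat) (g v) (fun _ r => S r) (f v)).
  - intros v. induction (f v); simpl; congruence.
  - apply rec_nat_rect; auto. apply rec_S, rec_nth.
Qed.

Lemma rec_pred X f : rec X f -> rec X (fun v => pred (f v)).
Proof.
  intros Hf.
  apply rec_ext with (fun v => nat_rect (fun _ => nat) 0 (fun m _ => m) (f v)).
  - intros v. now destruct (f v).
  - apply rec_nat_rect; auto. apply rec_const. apply rec_nth.
Qed.

Lemma rec_sub X f g : rec X f -> rec X g -> rec X (fun v => f v - g v).
Proof.
  intros Hf Hg.
  apply rec_ext with (fun v => nat_rect (fun _ => nat) (f v) (fun _ r => pred r) (g v)).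
  - intros v. induction (g v) as [|n IH]; simpl; [lia|]. rewrite IH. lia.
  - apply rec_nat_rect; auto. apply rec_pred, rec_nth.
Qed.

Lemma rec_mul X f g : rec X f -> rec X g -> rec X (fun v => f v * g v).
Proof.
  intros Hf Hg.
  apply rec_ext with (fun v => nat_rect (fun _ => nat) 0 (fun _ r => g v + r) (f v)).
  - intros v. induction (f v) as [|n IH]; simpl; congruence.
  - apply (rec_nat_rect X (fun _ => 0) f (fun v _ r => g v + r)); auto.
    + apply rec_const.
    + apply rec_add; [exact (rec_tl _ _ (rec_tl _ _ Hg)) | apply rec_nth].
Qed.

Lemma rec_pow X f g : rec X f -> rec X g -> rec X (fun v => f v ^ g v).
Proof.
  intros Hf Hg.
  apply rec_ext with (fun v => nat_rect (fun _ => nat) 1 (fun _ r => f v * r) (g v)).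
  - intros v. induction (g v) as [|n IH]; simpl; congruence.
  - apply (rec_nat_rect X (fun _ => 1) g (fun v _ r => f v * r)); auto.
    + apply rec_const.
    + apply rec_mul; [exact (rec_tl _ _ (rec_tl _ _ Hf)) | apply rec_nth].
Qed.

Lemma dec_eq X f g : rec X f -> rec X g -> dec X (fun v => f v = g v).
Proof.
  intros Hf Hg. exists (fun v => (f v - g v) + (g v - f v)). split.
  - apply rec_add; now apply rec_sub.
  - intros v. lia.
Qed.

Lemma dec_le X f g : rec X f -> rec X g -> dec X (fun v => f v <= g v).
Proof.
  intros Hf Hg. exists (fun v => f v - g v). split; [now apply rec_sub|].
  intros v. lia.
Qed.

Lemma dec_lt X f g : rec X f -> rec X g -> dec X (fun v => f v < g v).
Proof. intros Hf. apply (dec_le X (fun v => S (f v))). now apply rec_S. Qed.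

Lemma dec_and X P Q : dec X P -> dec X Q -> dec X (fun v => P v /\ Q v).
Proof.
  intros (f & Hf & HP) (g & Hg & HQ). exists (fun v => f v + g v).
  split; [now apply rec_add|]. intros v. rewrite HP, HQ. lia.
Qed.

Lemma dec_or X P Q : dec X P -> dec X Q -> dec X (fun v => P v \/ Q v).
Proof.
  intros (f & Hf & HP) (g & Hg & HQ). exists (fun v => f v * g v).
  split; [now apply rec_mul|]. intros v. rewrite HP, HQ. symmetry. apply Nat.eq_mul_0.
Qed.

Lemma dec_not X P : dec X P -> dec X (fun v => ~ P v).
Proof.
  intros (f & Hf & HP). exists (fun v => 1 - f v).
  split; [apply rec_sub; auto using rec_const|]. intros v. rewrite HP. lia.
Qed.

Lemma dec_impl X (P Q : list nat -> Prop) :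
  dec X P -> dec X Q -> dec X (fun v => P v -> Q v).
Proof.
  intros HP HQ. apply dec_ext with (fun v => ~ P v \/ Q v).
  - intros v. tauto.
  - apply dec_or; auto using dec_not.
Qed.

Lemma dec_iff X (P Q : list nat -> Prop) :
  dec X P -> dec X Q -> dec X (fun v => P v <-> Q v).
Proof. intros HP HQ. apply dec_and; now apply dec_impl. Qed.

Lemma dec_oracle X f : rec X f -> dec X (fun v => X (f v) = true).
Proof.
  intros Hf. exists (fun v => 1 - if X (f v) then 1 else 0). split.
  - apply rec_sub; [apply rec_const | now apply rec_oracle].
  - intros v. destruct (X (f v)); simpl; split; congruence.
Qed.

(** Bounded quantifiers get names so that decidability proofs can follow the syntax of a formula. *)
Definition ball (n : nat) (P : nat -> Prop) : Prop := forall i, i < n -> P i.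
Definition bex (n : nat) (P : nat -> Prop) : Prop := exists i, i < n /\ P i.

Lemma dec_ball X b (P : list nat -> nat -> Prop) :
  rec X b -> dec X (fun w => P (tl w) (nth 0 w 0)) ->
  dec X (fun v => ball (b v) (P v)).
Proof.
  intros Hb (f & Hf & HP).
  exists (fun v => nat_rect (fun _ => nat) 0 (fun i r => f (i :: v) + r) (b v)). split.
  - apply (rec_nat_rect X (fun _ => 0) b (fun v i r => f (i :: v) + r));
      [apply rec_const | exact Hb |].
    apply rec_add; [|apply rec_nth].
    apply (rec_subst X f (fun w => nth 0 w 0 :: tl (tl w))); [exact Hf|].
    intros [|i]; rvar.
  - intros v. unfold ball. induction (b v) as [|n IH]; simpl.
    + split; [reflexivity | lia].
    + rewrite Nat.eq_add_0, <- IH, <- (HP (n :: v)). simpl. split.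
      * intros H. split; [apply H; lia | intros; apply H; lia].
      * intros [H1 H2] i Hi. destruct (Nat.eq_dec i n) as [->|]; [exact H1|].
        apply H2. lia.
Qed.

Lemma dec_bex X b (P : list nat -> nat -> Prop) :
  rec X b -> dec X (fun w => P (tl w) (nth 0 w 0)) ->
  dec X (fun v => bex (b v) (P v)).
Proof.
  intros Hb HP. apply dec_ext with (fun v => ~ ball (b v) (fun i => ~ P v i)).
  - intros v. unfold ball, bex. split.
    + intros H. apply not_all_ex_not in H. destruct H as [i H].
      exists i. tauto.
    + intros (i & Hi & H) H'. exact (H' i Hi H).
  - apply dec_not. apply (dec_ball X b (fun v i => ~ P v i)); auto using dec_not.
Qed.

Definition ite (P : Prop) (a b : nat) : nat :=
  if excluded_middle_informative P then a else b.

Lemma ite_true (P : Prop) a b : P -> ite P a b = a.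
Proof. unfold ite. now destruct excluded_middle_informative. Qed.

Lemma ite_false (P : Prop) a b : ~ P -> ite P a b = b.
Proof. unfold ite. now destruct excluded_middle_informative. Qed.

Lemma rec_ite X P f g : dec X P -> rec X f -> rec X g ->
  rec X (fun v => ite (P v) (f v) (g v)).
Proof.
  intros (d & Hd & HP) Hf Hg.
  apply rec_ext with (fun v => nat_rect (fun _ => nat) (f v) (fun _ _ => g v) (d v)).
  - intros v. destruct (classic (P v)) as [H|H].
    + rewrite ite_true by assumption. apply HP in H. now rewrite H.
    + rewrite ite_false by assumption. rewrite HP in H. now destruct (d v).
  - apply (rec_nat_rect X f d (fun v _ _ => g v)); auto. exact (rec_tl _ _ (rec_tl _ _ Hg)).
Qed.

(** Placeholders, redefined as closure properties of further functions and relations become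
    available. *)
Ltac rec_arith := fail.
Ltac rec_lists := fail.
Ltac rec_programs := fail.
Ltac rec_conditions := fail.

Ltac rhyp :=
  match goal with
  | H : rec ?X ?f |- rec ?X _ =>
      let H1 := constr:(rec_tl _ _ H) in
      let H2 := constr:(rec_tl _ _ H1) in
      let H3 := constr:(rec_tl _ _ H2) in
      let H4 := constr:(rec_tl _ _ H3) in
      let H5 := constr:(rec_tl _ _ H4) in
      first [ exact H | exact H1 | exact H2 | exact H3 | exact H4 | exact H5 ]
  end.

Ltac rstep :=
  cbv beta;
  lazymatch goal with
  | |- rec _ (fun v => nth _ _ _) => rvar
  | |- rec _ (fun v => S _) => first [ apply rec_const | apply rec_S ]
  | |- rec _ (fun v => _ + _) => first [ apply rec_const | apply rec_add ]
  | |- rec _ (fun v => _ - _) => first [ apply rec_const | apply rec_sub ]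
  | |- rec _ (fun v => _ * _) => first [ apply rec_const | apply rec_mul ]
  | |- rec _ (fun v => _ ^ _) => first [ apply rec_const | apply rec_pow ]
  | |- rec _ (fun v => pred _) => apply rec_pred
  | |- rec _ (fun v => ite _ _ _) => apply rec_ite
  | |- rec _ (fun v => nat_rect _ _ _ _) => apply rec_nat_rect
  | |- dec _ (fun v => _ /\ _) => apply dec_and
  | |- dec _ (fun v => _ \/ _) => apply dec_or
  | |- dec _ (fun v => ~ _) => apply dec_not
  | |- dec _ (fun v => _ <-> _) => apply dec_iff
  | |- dec _ (fun v => _ <= _) => apply dec_le
  | |- dec _ (fun v => _ < _) => apply dec_lt
  | |- dec _ (fun v => ball _ _) => apply dec_ball
  | |- dec _ (fun v => bex _ _) => apply dec_bex
  | |- dec _ (fun v => @eq nat _ _) => apply dec_eq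
  | |- dec _ (fun v => _ -> _) => apply dec_impl
  | _ => first [ assumption | rhyp | rec_arith | rec_lists | rec_programs | rec_conditions
             | apply rec_const ]
  end; cbv beta.

Ltac rsolve := repeat rstep.

Lemma rec_div X f g : rec X f -> rec X g -> rec X (fun v => f v / g v).
Proof.
  intros Hf Hg.
  (* Division by 0 has the value 0, hence the separate disjunct. *)
  apply rec_least with
    (fun q v => g v = 0 /\ q = 0 \/ ~ g v = 0 /\ f v < S q * g v).
  - rsolve.
  - intros v. destruct (Nat.eq_dec (g v) 0) as [E|E].
    + rewrite E. simpl. split; [auto | lia].
    + pose proof (Nat.div_mod_eq (f v) (g v)) as H.
      pose proof (Nat.mod_upper_bound (f v) (g v) E) as H'.
      split; [right; split; [assumption|nia]|].
      intros n Hn [[]|[_ H1]]; [lia|nia].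
Qed.

Lemma rec_mod X f g : rec X f -> rec X g -> rec X (fun v => f v mod g v).
Proof.
  intros Hf Hg. apply rec_ext with (fun v => f v - g v * (f v / g v)).
  - intros v. pose proof (Nat.div_mod_eq (f v) (g v)). lia.
  - rsolve. now apply rec_div.
Qed.

Lemma dec_testbit X f g : rec X f -> rec X g ->
  dec X (fun v => Nat.testbit (f v) (g v) = true).
Proof.
  intros Hf Hg. apply dec_ext with (fun v => (f v / 2 ^ g v) mod 2 = 1).
  - intros v. rewrite <- Nat.testbit_spec'. destruct Nat.testbit; simpl; split; congruence.
  - apply dec_eq; [|apply rec_const]. apply rec_mod; [|apply rec_const].
    apply rec_div; rsolve.
Qed.

Lemma rec_pair X f g : rec X f -> rec X g -> rec X (fun v => to_nat (f v, g v)).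
Proof.
  intros Hf Hg.
  apply rec_ext with
    (fun v => g v + nat_rect (fun _ => nat) 0 (fun i m => S i + m) (g v + f v)).
  - reflexivity.
  - rsolve.
Qed.

Definition p1 (n : nat) : nat := fst (of_nat n).
Definition p2 (n : nat) : nat := snd (of_nat n).

Lemma p1_pair a b : p1 (to_nat (a, b)) = a.
Proof. unfold p1. now rewrite cancel_of_to. Qed.

Lemma p2_pair a b : p2 (to_nat (a, b)) = b.
Proof. unfold p2. now rewrite cancel_of_to. Qed.

Lemma pair_p n : to_nat (p1 n, p2 n) = n.
Proof. unfold p1, p2. now rewrite <- surjective_pairing, cancel_to_of. Qed.

Lemma pair_le a b : a <= to_nat (a, b) /\ b <= to_nat (a, b).
Proof. pose proof (to_nat_non_decreasing a b). lia. Qed.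

Lemma p1_le n : p1 n <= n.
Proof. rewrite <- (pair_p n) at 2. apply pair_le. Qed.

Lemma p2_le n : p2 n <= n.
Proof. rewrite <- (pair_p n) at 2. apply pair_le. Qed.

Lemma rec_p1 X f : rec X f -> rec X (fun v => p1 (f v)).
Proof.
  intros Hf.
  apply rec_least with (fun a v => bex (S (f v)) (fun b => to_nat (a, b) = f v)).
  - rsolve. apply rec_pair; rsolve.
  - intros v. split.
    + exists (p2 (f v)). split; [pose proof (p2_le (f v)); lia | apply pair_p].
    + intros n Hn (b & _ & Hb). rewrite <- Hb, p1_pair in Hn. lia.
Qed.

Lemma rec_p2 X f : rec X f -> rec X (fun v => p2 (f v)).
Proof.
  intros Hf.
  apply rec_least with (fun b v => bex (S (f v)) (fun a => to_nat (a, b) = f v)).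
  - rsolve. apply rec_pair; rsolve.
  - intros v. split.
    + exists (p1 (f v)). split; [pose proof (p1_le (f v)); lia | apply pair_p].
    + intros n Hn (b & _ & Hb). rewrite <- Hb, p2_pair in Hn. lia.
Qed.

Ltac rec_arith ::=
  lazymatch goal with
  | |- rec _ (fun v => to_nat _) => apply rec_pair
  | |- rec _ (fun v => _ / _) => apply rec_div
  | |- rec _ (fun v => _ mod _) => apply rec_mod
  | |- rec _ (fun v => p1 _) => apply rec_p1
  | |- rec _ (fun v => p2 _) => apply rec_p2
  | |- dec _ (fun v => Nat.testbit _ _ = true) => apply dec_testbit
  end.

(** * Derivations as numbers *)

(** This is the list coding built into [decode] for the arguments of [CComp]. *)
Fixpoint ldec_aux (fuel m : nat) : list nat :=
  match fuel, m with
  | S fuel, S m => p1 m :: ldec_aux fuel (p2 m)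
  | _, _ => []
  end.

Definition ldec (m : nat) : list nat := ldec_aux m m.
Definition lcons (a l : nat) : nat := S (to_nat (a, l)).
(** On the code 0 of the empty list [lhd] and [ltl] give 0, in agreement with [hd 0] and [tl]. *)
Definition lhd (x : nat) : nat := p1 (pred x).
Definition ltl (x : nat) : nat := p2 (pred x).
Definition ldrop (q x : nat) : nat := nat_rect (fun _ => nat) x (fun _ r => ltl r) q.

Fixpoint lenc (l : list nat) : nat :=
  match l with
  | [] => 0
  | a :: l => lcons a (lenc l)
  end.

Lemma ldec_aux_fuel f : forall f' m, m <= f -> m <= f' -> ldec_aux f m = ldec_aux f' m.
Proof.
  induction f as [|f IH]; intros [|f'] [|m] H H'; simpl; try lia; try reflexivity.
  f_equal. pose proof (p2_le m). apply IH; lia.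
Qed.

Lemma ldec_S m : ldec (S m) = p1 m :: ldec (p2 m).
Proof.
  unfold ldec. simpl. f_equal. pose proof (p2_le m). apply ldec_aux_fuel; lia.
Qed.

Lemma ldec_lcons a l : ldec (lcons a l) = a :: ldec l.
Proof. unfold lcons. now rewrite ldec_S, p1_pair, p2_pair. Qed.

Lemma lhd_lcons a l : lhd (lcons a l) = a.
Proof. apply p1_pair. Qed.

Lemma ltl_lcons a l : ltl (lcons a l) = l.
Proof. apply p2_pair. Qed.

Lemma ldec_lenc l : ldec (lenc l) = l.
Proof. induction l as [|a l IH]; [reflexivity|]. simpl. now rewrite ldec_lcons, IH. Qed.

Lemma hd_ldec x : hd 0 (ldec x) = lhd x.
Proof. destruct x; [reflexivity | now rewrite ldec_S]. Qed.

Lemma tl_ldec x : tl (ldec x) = ldec (ltl x).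
Proof. destruct x; [reflexivity | now rewrite ldec_S]. Qed.

Lemma ldrop_S q x : ldrop (S q) x = ldrop q (ltl x).
Proof.
  unfold ldrop. simpl. induction q as [|q IH]; [reflexivity|]. simpl. now rewrite IH.
Qed.

Lemma nth_ldec q : forall x, nth q (ldec x) 0 = lhd (ldrop q x).
Proof.
  induction q as [|q IH]; intros x.
  - rewrite nth_0_hd. apply hd_ldec.
  - now rewrite <- nth_tl, tl_ldec, IH, ldrop_S.
Qed.

Lemma ldrop_0 q : ldrop q 0 = 0.
Proof. induction q as [|q IH]; [reflexivity|]. now rewrite ldrop_S. Qed.

Lemma ltl_lt x : x <> 0 -> ltl x < x.
Proof. destruct x; [lia|]. intros _. unfold ltl. simpl. pose proof (p2_le x). lia. Qed.

Lemma rec_lcons X f g : rec X f -> rec X g -> rec X (fun v => lcons (f v) (g v)).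
Proof. intros. unfold lcons. rsolve. Qed.
Lemma rec_lhd X f : rec X f -> rec X (fun v => lhd (f v)).
Proof. intros. unfold lhd. rsolve. Qed.
Lemma rec_ltl X f : rec X f -> rec X (fun v => ltl (f v)).
Proof. intros. unfold ltl. rsolve. Qed.
Lemma rec_ldrop X f g : rec X f -> rec X g -> rec X (fun v => ldrop (f v) (g v)).
Proof. intros. unfold ldrop. rsolve. apply rec_ltl. rsolve. Qed.

Definition lmem (m d : nat) : Prop :=
  bex d (fun q => ldrop q d <> 0 /\ lhd (ldrop q d) = m).

Lemma lmem_spec m d : lmem m d <-> In m (ldec d).
Proof.
  induction d as [d IH] using (well_founded_induction lt_wf).
  destruct d as [|d].
  - simpl. split; [|tauto]. intros (q & Hq & _). lia.
  - rewrite ldec_S. simpl.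
    assert (Hlt : p2 d < S d) by (pose proof (p2_le d); lia).
    rewrite <- (IH _ Hlt). unfold lmem, bex. split.
    + intros ([|q] & Hq & H0 & H1).
      * now left.
      * right. rewrite ldrop_S in H0, H1. exists q. split; [|auto].
        change (ltl (S d)) with (p2 d) in *.
        assert (Hz : forall q x, x <= q -> ldrop q x = 0).
        { clear. induction q as [|q IH]; intros x Hx.
          - now replace x with 0 by lia.
          - rewrite ldrop_S. destruct (Nat.eq_dec x 0) as [->|Hne]; [apply ldrop_0|].
            apply IH. pose proof (ltl_lt x Hne). lia. }
        destruct (le_lt_dec (p2 d) q) as [Hle|]; [|assumption].
        now rewrite (Hz q _ Hle) in H0.
    + intros [H|(q & Hq & H0 & H1)].
      * exists 0. simpl. split; [lia|]. auto.
      * exists (S q). rewrite ldrop_S. split; [lia|]. auto.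
Qed.

Lemma dec_lmem X f g : rec X f -> rec X g -> dec X (fun v => lmem (f v) (g v)).
Proof.
  intros. unfold lmem. rsolve.
  - apply rec_ldrop; rsolve.
  - apply rec_lhd, rec_ldrop; rsolve.
Qed.

(** * Fuel-free equations for decoding programs *)

Fixpoint map_ldec (D : nat -> code) (fuel m : nat) : list code :=
  match fuel, m with
  | S fuel, S m => D (p1 m) :: map_ldec D fuel (p2 m)
  | _, _ => []
  end.

Lemma map_ldec_eq D D' fuel : forall fuel' m, m <= fuel -> m <= fuel' ->
  (forall i, i < m -> D i = D' i) -> map_ldec D fuel m = map D' (ldec_aux fuel' m).
Proof.
  induction fuel as [|fuel IH]; intros [|fuel'] [|m] H H' HD; simpl; try lia; try reflexivity.
  pose proof (p1_le m). pose proof (p2_le m). f_equal; [apply HD; lia|].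
  apply IH; [lia..|]. intros. apply HD. lia.
Qed.

Lemma decode_aux_S fuel n : decode_aux (S fuel) n =
  match n mod 7 with
  | 0 => CZero
  | 1 => CSucc
  | 2 => CProj (n / 7)
  | 3 => COracle
  | 4 => CComp (decode_aux fuel (p1 (n / 7)))
           (map_ldec (decode_aux fuel) (S (p2 (n / 7))) (p2 (n / 7)))
  | 5 => CPrimRec (decode_aux fuel (p1 (n / 7))) (decode_aux fuel (p2 (n / 7)))
  | _ => CMu (decode_aux fuel (n / 7))
  end.
Proof.
  unfold decode_aux at 1; fold decode_aux.
  destruct (n mod 7) as [|[|[|[|[|[|t]]]]]]; try reflexivity;
    unfold p1, p2; destruct (of_nat (n / 7)) as [a b]; cbn [fst snd]; [|reflexivity].
  apply (f_equal (CComp _)).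
  set (dl := fix dlist (fl m : nat) : list code := _).
  assert (H : forall fl m, dl fl m = map_ldec (decode_aux fuel) fl m).
  { induction fl as [|fl IH]; intros [|m]; try reflexivity.
    simpl. unfold p1, p2. destruct (of_nat m) as [a' c']. simpl. now rewrite IH. }
  exact (H (S b) b).
Qed.

Lemma decode_aux_fuel f : forall f' n, n < f -> n < f' -> decode_aux f n = decode_aux f' n.
Proof.
  induction f as [|f IH]; intros [|f'] n H H'; try lia. rewrite !decode_aux_S.
  pose proof (Nat.div_mod_eq n 7) as Hn.
  pose proof (p1_le (n / 7)) as H1. pose proof (p2_le (n / 7)) as H2.
  destruct (n mod 7) as [|[|[|[|[|[|t]]]]]] eqn:Ht; try reflexivity.
  - f_equal; [apply IH; lia|].
    set (b := p2 (n / 7)) in *.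
    rewrite (map_ldec_eq _ (decode_aux f') (S b) (S b)) by (try lia; intros; apply IH; lia).
    now rewrite (map_ldec_eq _ (decode_aux f') (S b) (S b)) by (try lia; reflexivity).
  - f_equal; apply IH; lia.
  - f_equal; apply IH; lia.
Qed.

Lemma decode_eq n : decode n =
  match n mod 7 with
  | 0 => CZero
  | 1 => CSucc
  | 2 => CProj (n / 7)
  | 3 => COracle
  | 4 => CComp (decode (p1 (n / 7))) (map decode (ldec (p2 (n / 7))))
  | 5 => CPrimRec (decode (p1 (n / 7))) (decode (p2 (n / 7)))
  | _ => CMu (decode (n / 7))
  end.
Proof.
  unfold decode at 1. rewrite decode_aux_S.
  pose proof (Nat.div_mod_eq n 7) as Hn.
  pose proof (p1_le (n / 7)) as H1. pose proof (p2_le (n / 7)) as H2.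
  destruct (n mod 7) as [|[|[|[|[|[|t]]]]]] eqn:Ht; try reflexivity.
  - f_equal; [apply decode_aux_fuel; lia|].
    apply map_ldec_eq; [lia..|]. intros i Hi. apply decode_aux_fuel; lia.
  - f_equal; apply decode_aux_fuel; lia.
  - f_equal; apply decode_aux_fuel; lia.
Qed.

Fixpoint encode (c : code) : nat :=
  match c with
  | CZero => 0
  | CSucc => 1
  | CProj i => 2 + i * 7
  | COracle => 3
  | CComp f gs => 4 + to_nat (encode f, lenc (map encode gs)) * 7
  | CPrimRec f g => 5 + to_nat (encode f, encode g) * 7
  | CMu f => 6 + encode f * 7
  end.

Lemma decode_tag t r : t < 7 -> (t + r * 7) mod 7 = t /\ (t + r * 7) / 7 = r.
Proof.
  intros Ht. rewrite Nat.Div0.mod_add, Nat.div_add by lia.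
  rewrite Nat.mod_small, Nat.div_small by assumption. auto.
Qed.

Lemma decode_encode c : decode (encode c) = c.
Proof.
  induction c as [| |i| |f gs IHf IHgs|f g IHf IHg|f IHf] using code_nested_ind;
    try reflexivity; cbn [encode]; rewrite decode_eq.
  - destruct (decode_tag 2 i) as [-> ->]; [lia|reflexivity].
  - destruct (decode_tag 4 (to_nat (encode f, lenc (map encode gs)))) as [-> ->]; [lia|].
    rewrite p1_pair, p2_pair, ldec_lenc, IHf, map_map. f_equal.
    induction IHgs; simpl; congruence.
  - destruct (decode_tag 5 (to_nat (encode f, encode g))) as [-> ->]; [lia|].
    now rewrite p1_pair, p2_pair, IHf, IHg.
  - destruct (decode_tag 6 (encode f)) as [-> ->]; [lia|]. now rewrite IHf.
Qed.

(* Entry [ent 0 e x v]: program [e] maps [ldec x] to [v];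
   entry [ent 1 b x y]: the programs in [ldec b] map [ldec x] to the values [ldec y]. *)
Definition ent (k e x v : nat) : nat := to_nat (k, to_nat (e, to_nat (x, v))).

(* The residues modulo 7 are the tags of [decode]. *)
Definition just0 (sg s : nat) (M : nat -> Prop) (e x v : nat) : Prop :=
  e mod 7 = 0 /\ v = 0 \/
  e mod 7 = 1 /\ v = S (lhd x) \/
  e mod 7 = 2 /\ v = lhd (ldrop (e / 7) x) \/
  e mod 7 = 3 /\ lhd x < s /\
    (Nat.testbit sg (lhd x) = true /\ v = 1 \/ ~ Nat.testbit sg (lhd x) = true /\ v = 0) \/
  e mod 7 = 4 /\
    bex s (fun y => M (ent 1 (p2 (e / 7)) x y) /\ M (ent 0 (p1 (e / 7)) y v)) \/
  e mod 7 = 5 /\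
    (lhd x = 0 /\ M (ent 0 (p1 (e / 7)) (ltl x) v) \/
     ~ lhd x = 0 /\
     bex s (fun w => M (ent 0 e (lcons (pred (lhd x)) (ltl x)) w) /\
       M (ent 0 (p2 (e / 7)) (lcons (pred (lhd x)) (lcons w (ltl x))) v))) \/
  e mod 7 = 6 /\ M (ent 0 (e / 7) (lcons v x) 0) /\
    ball v (fun n => bex s (fun u => M (ent 0 (e / 7) (lcons n x) (S u)))).

Definition just1 (M : nat -> Prop) (b x y : nat) : Prop :=
  b = 0 /\ y = 0 \/
  ~ b = 0 /\ ~ y = 0 /\ M (ent 0 (lhd b) x (lhd y)) /\ M (ent 1 (ltl b) x (ltl y)).

Definition just (sg s : nat) (M : nat -> Prop) (n : nat) : Prop :=
  p1 n = 0 /\ just0 sg s M (p1 (p2 n)) (p1 (p2 (p2 n))) (p2 (p2 (p2 n))) \/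
  p1 n = 1 /\ just1 M (p1 (p2 n)) (p1 (p2 (p2 n))) (p2 (p2 (p2 n))).

(** A derivation is read from its end: each entry is justified by the entries after it. *)
Fixpoint closed (sg s : nat) (l : list nat) : Prop :=
  match l with
  | [] => True
  | n :: l => just sg s (fun m => In m l) n /\ closed sg s l
  end.

Definition lclosed (sg s d : nat) : Prop :=
  ball d (fun q => ldrop q d <> 0 ->
    just sg s (fun m => lmem m (ldrop (S q) d)) (lhd (ldrop q d))).

(* One number [s] bounds the oracle queries, the derivation and its witnesses. *)
Definition computes_within (sg s e x v : nat) : Prop :=
  bex s (fun d => lclosed sg s d /\ lmem (ent 0 e x v) d).

Definition halts_within (sg s e x : nat) : Prop := bex s (fun v => computes_within sg s e x v).

Lemma rec_ent X f g h k : rec X f -> rec X g -> rec X h -> rec X k ->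
  rec X (fun v => ent (f v) (g v) (h v) (k v)).
Proof. intros. unfold ent. rsolve. Qed.

Ltac rec_lists ::=
  lazymatch goal with
  | |- rec _ (fun v => lhd _) => apply rec_lhd
  | |- rec _ (fun v => ltl _) => apply rec_ltl
  | |- rec _ (fun v => lcons _ _) => apply rec_lcons
  | |- rec _ (fun v => ldrop _ _) => apply rec_ldrop
  | |- rec _ (fun v => ent _ _ _ _) => apply rec_ent
  | |- dec _ (fun v => lmem _ _) => apply dec_lmem
  end.

Lemma dec_just X f g h k : rec X f -> rec X g -> rec X h -> rec X k ->
  dec X (fun v => just (f v) (g v) (fun m => lmem m (h v)) (k v)).
Proof. intros. unfold just, just0, just1. rsolve. Qed.

Lemma dec_computes_within X f g h k l : rec X f -> rec X g -> rec X h -> rec X k -> rec X l ->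
  dec X (fun v => computes_within (f v) (g v) (h v) (k v) (l v)).
Proof. intros. unfold computes_within, lclosed. rsolve. apply dec_just; rsolve. Qed.

Lemma dec_halts_within X f g h k : rec X f -> rec X g -> rec X h -> rec X k ->
  dec X (fun v => halts_within (f v) (g v) (h v) (k v)).
Proof. intros. unfold halts_within. rsolve. apply dec_computes_within; rsolve. Qed.

(** * Finite oracles as bit strings *)

Definition bit (n i : nat) : bool := Nat.testbit n i.

Definition agree (s : nat) (X Y : nat -> bool) : Prop := forall i, i < s -> X i = Y i.

Definition pre (X : nat -> bool) (s : nat) : nat :=
  nat_rect (fun _ => nat) 0 (fun i r => r + ite (X i = true) (2 ^ i) 0) s.

Lemma pow2_pos i : 0 < 2 ^ i.
Proof. apply Nat.neq_0_lt_0, Nat.pow_nonzero. lia. Qed.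

Lemma pre_lt X s : pre X s < 2 ^ s.
Proof.
  induction s as [|s IH]; simpl; [lia|]. fold (pre X s).
  unfold ite. destruct excluded_middle_informative; lia.
Qed.

Lemma bit_small n s i : n < 2 ^ s -> s <= i -> bit n i = false.
Proof.
  intros Hn Hi. unfold bit. apply Nat.b2n_inj. rewrite Nat.testbit_spec'.
  rewrite Nat.div_small; [reflexivity|].
  pose proof (Nat.pow_le_mono_r 2 s i). lia.
Qed.

Lemma bit_add_pow_lt n s i : i < s -> bit (n + 2 ^ s) i = bit n i.
Proof.
  intros Hi. unfold bit. apply Nat.b2n_inj. rewrite !Nat.testbit_spec'.
  replace (2 ^ s) with (2 ^ (s - i - 1) * 2 * 2 ^ i).
  - rewrite Nat.div_add by (pose proof (pow2_pos i); lia).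
    now rewrite Nat.Div0.mod_add.
  - transitivity (2 ^ (s - i - 1) * 2 ^ 1 * 2 ^ i); [reflexivity|].
    rewrite <- !Nat.pow_add_r. f_equal. lia.
Qed.

Lemma bit_add_pow_eq n s : n < 2 ^ s -> bit (n + 2 ^ s) s = true.
Proof.
  intros Hn. unfold bit. apply Nat.b2n_inj. rewrite Nat.testbit_spec'.
  replace (n + 2 ^ s) with (n + 1 * 2 ^ s) by lia.
  rewrite Nat.div_add by (pose proof (pow2_pos s); lia).
  now rewrite Nat.div_small.
Qed.

Lemma bit_pre X s i : i < s -> bit (pre X s) i = X i.
Proof.
  induction s as [|s IH]; [lia|]. intros Hi. simpl. fold (pre X s).
  pose proof (pre_lt X s) as Hlt. unfold ite.
  destruct (Nat.eq_dec i s) as [->|Hne]; destruct excluded_middle_informative as [E|E].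
  - rewrite E. now apply bit_add_pow_eq.
  - rewrite Nat.add_0_r, (bit_small _ s) by auto. now destruct (X s).
  - rewrite bit_add_pow_lt by lia. apply IH. lia.
  - rewrite Nat.add_0_r. apply IH. lia.
Qed.

Lemma agree_pre X s : agree s (bit (pre X s)) X.
Proof. intros i. apply bit_pre. Qed.

Lemma agree_sym s X Y : agree s X Y -> agree s Y X.
Proof. intros H i Hi. symmetry. auto. Qed.

Lemma agree_trans s X Y Z : agree s X Y -> agree s Y Z -> agree s X Z.
Proof. intros H H' i Hi. rewrite H by assumption. auto. Qed.

Lemma agree_le s t X Y : s <= t -> agree t X Y -> agree s X Y.
Proof. intros Hst H i Hi. apply H. lia. Qed.

Lemma rec_pre X b (Q : list nat -> nat -> bool) : rec X b ->
  dec X (fun w => Q (tl w) (nth 0 w 0) = true) -> rec X (fun v => pre (Q v) (b v)).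
Proof.
  intros Hb HQ. unfold pre.
  apply (rec_nat_rect X (fun _ => 0) b (fun v i r => r + ite (Q v i = true) (2 ^ i) 0)); rsolve.
  apply (dec_subst X _ (fun w => nth 0 w 0 :: tl (tl w)) HQ).
  intros [|i]; simpl; rsolve.
Qed.

Lemma dec_bit X f g : rec X f -> rec X g -> dec X (fun v => bit (f v) (g v) = true).
Proof. apply dec_testbit. Qed.

(** The membership predicate occurs only positively in the rules, witnesses are only bounded by [s],
    and the oracle is consulted only below [s]. *)
Lemma just_mono sg s sg' s' (M M' : nat -> Prop) n :
  s <= s' -> agree s (bit sg) (bit sg') -> (forall m, M m -> M' m) ->
  just sg s M n -> just sg' s' M' n.
Proof.
  intros Hs Ha HM. unfold just, just0, just1, bex, ball.
  intros [[H0 H]|[H1 H]]; [left|right]; (split; [assumption|]).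
  - destruct H as [H|[H|[H|[(H & Hl & H')|[(H & y & Hy & H1 & H2)|[(H & H')|(H & H1 & H2)]]]]]];
      auto 6.
    + right; right; right; left. split; [auto|]. split; [lia|].
      specialize (Ha _ Hl). unfold bit in Ha. now rewrite <- Ha.
    + right; right; right; right; left. split; [auto|]. exists y. split; [lia|auto].
    + right; right; right; right; right; left. split; [auto|].
      destruct H' as [H'|(H' & w & Hw & H1 & H2)]; [left; intuition|right].
      split; [auto|]. exists w. split; [lia|auto].
    + right; right; right; right; right; right. split; [auto|]. split; [auto|].
      intros i Hi. destruct (H2 i Hi) as (u & Hu & H3). exists u. split; [lia|auto].
  - intuition.
Qed.

Lemma closed_mono sg s sg' s' l : s <= s' -> agree s (bit sg) (bit sg') ->
  closed sg s l -> closed sg' s' l.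
Proof.
  intros Hs Ha. induction l as [|n l IH]; simpl; [auto|].
  intros [H1 H2]. split; [|auto].
  now apply (just_mono sg s sg' s' (fun m => In m l) (fun m => In m l)).
Qed.

Lemma closed_app sg s l l' : closed sg s l -> closed sg s l' -> closed sg s (l ++ l').
Proof.
  intros H H'. induction l as [|n l IH]; simpl in *; [assumption|].
  destruct H as [H1 H2]. split; [|auto].
  eapply just_mono; [apply le_n|intros i _; reflexivity| |exact H1].
  intros m Hm. apply in_or_app. now left.
Qed.

Lemma lclosed_iff sg s d : lclosed sg s d <-> closed sg s (ldec d).
Proof.
  assert (Hiff : forall (M M' : nat -> Prop) n, (forall m, M m <-> M' m) ->
            just sg s M n <-> just sg s M' n).
  { intros M M' n H. split; apply just_mono; try lia; try (intros i _; reflexivity);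
      intros m; apply H. }
  induction d as [d IH] using (well_founded_induction lt_wf).
  destruct d as [|d].
  - simpl. split; [auto|]. intros _ q Hq. lia.
  - assert (Hlt : p2 d < S d) by (pose proof (p2_le d); lia).
    rewrite ldec_S. simpl closed. rewrite <- (IH _ Hlt). unfold lclosed, ball.
    assert (H0 : just sg s (fun m => lmem m (ldrop 1 (S d))) (lhd (ldrop 0 (S d))) <->
                 just sg s (fun m => In m (ldec (p2 d))) (p1 d)).
    { apply Hiff. intros m. apply lmem_spec. }
    assert (HE : forall q, ldrop (S q) (S d) = ldrop q (p2 d)) by
      (intros q; apply ldrop_S).
    split.
    + intros H. split; [apply H0, H; simpl; lia|].
      intros q Hq Hne. specialize (H (S q)). rewrite !HE in H. apply H; [lia | assumption].
    + intros [H1 H2] [|q] Hq Hne; [now apply H0|].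
      rewrite !HE in *. apply H2; [|assumption].
      destruct (le_lt_dec (p2 d) q) as [Hle|]; [|assumption].
      exfalso. apply Hne. clear - Hle. revert Hle. generalize (p2 d) as x. clear.
      induction q as [|q IH]; intros x Hx.
      * now replace x with 0 by lia.
      * rewrite ldrop_S. destruct (Nat.eq_dec x 0) as [->|Hne]; [apply ldrop_0|].
        apply IH. pose proof (ltl_lt x Hne). lia.
Qed.

Lemma computes_within_mono sg s sg' s' e x v : s <= s' -> agree s (bit sg) (bit sg') ->
  computes_within sg s e x v -> computes_within sg' s' e x v.
Proof.
  intros Hs Ha (d & Hd & H1 & H2). exists d. split; [lia|]. split; [|assumption].
  rewrite lclosed_iff in *. eapply closed_mono; eauto.
Qed.

Lemma halts_within_mono sg s sg' s' e x : s <= s' -> agree s (bit sg) (bit sg') ->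
  halts_within sg s e x -> halts_within sg' s' e x.
Proof.
  intros Hs Ha (v & Hv & H). exists v. split; [lia|]. eapply computes_within_mono; eauto.
Qed.

(** * Soundness of derivations *)

Definition ent_true (X : nat -> bool) (k e x v : nat) : Prop :=
  match k with
  | 0 => evals_to X (decode e) (ldec x) v
  | _ => Forall2 (fun g y => evals_to X g (ldec x) y) (map decode (ldec e)) (ldec v)
  end.

Lemma just_sound X sg s M k e x v : agree s (bit sg) X ->
  (forall k e x v, M (ent k e x v) -> ent_true X k e x v) ->
  just sg s M (ent k e x v) -> ent_true X k e x v.
Proof.
  intros Ha HM. unfold just, ent. rewrite !p1_pair, !p2_pair, !p1_pair.
  intros [[-> H]|[-> H]].
  - unfold ent_true. rewrite decode_eq.
    destruct H as [H|[H|[H|[(H & Hl & H')|[(H & y & Hy & H1 & H2)|[(H & H')|(H & H1 & H2)]]]]]].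
    + destruct H as [H ->]. rewrite H. exists 1. reflexivity.
    + destruct H as [H ->]. rewrite H. exists 1. simpl. now rewrite hd_ldec.
    + destruct H as [H ->]. rewrite H. exists 1. cbn [eval]. now rewrite nth_ldec.
    + rewrite H. exists 1. cbn [eval]. rewrite hd_ldec. specialize (Ha _ Hl). unfold bit in Ha. rewrite <- Ha.
      destruct H' as [[-> ->]|[H' ->]]; [reflexivity|]. now destruct Nat.testbit.
    + rewrite H. apply HM in H1, H2. simpl in H1, H2. eapply evals_to_comp; eauto.
    + rewrite H. destruct H' as [[H0 H']|(H0 & w & Hw & H1 & H2)].
      * apply HM in H'. simpl in H'. destruct H' as [k0 Hk0]. exists (S k0).
        apply eval_primrec_iff. exists (fun _ => v). rewrite hd_ldec, H0, tl_ldec.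
        repeat split; [assumption|lia].
      * apply HM in H1, H2. simpl in H1, H2. rewrite decode_eq, H in H1.
        rewrite !ldec_lcons, <- tl_ldec in *.
        destruct H1 as [[|k1] H1]; [discriminate|].
        apply eval_primrec_iff in H1. destruct H1 as (R & HR0 & HRS & HR).
        simpl in HR0, HRS, HR. subst w.
        pose (m := pred (lhd x)). fold m in HRS, H2.
        assert (Hm : hd 0 (ldec x) = S m) by (rewrite hd_ldec; unfold m; lia).
        (* The entry for the same program at the predecessor yields the trace up to [m]; the value
           of the step program prolongs it to [S m]. *)
        pose (R' := fun i => if i <=? m then R i else v).
        assert (HR' : forall i, i <= m -> R' i = R i).
        { intros i Hi. unfold R'. apply Nat.leb_le in Hi. now rewrite Hi. }
        assert (Hv : R' (S m) = v).
        { unfold R'. replace (S m <=? m) with false; [reflexivity|].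
          symmetry. apply Nat.leb_gt. lia. }
        rewrite <- Hv, <- Hm. apply evals_to_primrec.
        -- rewrite HR' by lia. exists k1. exact HR0.
        -- intros i Hi. rewrite Hm in Hi. rewrite (HR' i) by lia.
           destruct (Nat.eq_dec i m) as [->|Hne].
           ++ rewrite Hv. exact H2.
           ++ rewrite HR' by lia. exists k1. apply HRS. fold m. lia.
    + rewrite H. apply HM in H1. simpl in H1. rewrite ldec_lcons in H1.
      apply evals_to_mu; [assumption|]. intros n Hn.
      destruct (H2 n Hn) as (u & _ & Hu). apply HM in Hu. simpl in Hu.
      rewrite ldec_lcons in Hu. eauto.
  - unfold ent_true. destruct H as [[-> ->]|(H1 & H2 & H3 & H4)]; [constructor|].
    apply HM in H3, H4. simpl in H3, H4.
    destruct e as [|e], v as [|v]; try lia. rewrite !ldec_S. simpl.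
    constructor; assumption.
Qed.

Lemma closed_sound X sg s l : agree s (bit sg) X -> closed sg s l ->
  forall k e x v, In (ent k e x v) l -> ent_true X k e x v.
Proof.
  intros Ha. induction l as [|n l IH]; simpl; [tauto|].
  intros [H1 H2] k e x v [->|Hin]; [|auto].
  eapply just_sound; eauto. simpl. auto.
Qed.

(** * Completeness of derivations *)

(** Derivations of subcomputations are concatenated and their bounds added, so a derivation has to
    stay closed under every larger bound and every sufficiently long code of the oracle. *)
Definition closed_for (X : nat -> bool) (l : list nat) (s0 : nat) : Prop :=
  forall s sg, s0 <= s -> agree s (bit sg) X -> closed sg s l.

Definition provable (X : nat -> bool) (k e x v : nat) : Prop :=
  exists l s0, closed_for X l s0 /\ In (ent k e x v) l.

Lemma closed_for_app X l s0 l' s1 : closed_for X l s0 -> closed_for X l' s1 ->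
  closed_for X (l ++ l') (s0 + s1).
Proof.
  intros H H' s sg Hs Ha. apply closed_app; [apply H | apply H']; auto; lia.
Qed.

Lemma closed_for_cons X l s0 s1 k e x v : closed_for X l s0 ->
  (forall s sg, s1 <= s -> agree s (bit sg) X ->
     just sg s (fun m => In m l) (ent k e x v)) -> provable X k e x v.
Proof.
  intros H H'. exists (ent k e x v :: l), (s0 + s1). split; [|now left].
  intros s sg Hs Ha. simpl. split; [apply H' | apply H]; auto; lia.
Qed.

Lemma just_ent sg s M k e x v : just sg s M (ent k e x v) <->
  k = 0 /\ just0 sg s M e x v \/ k = 1 /\ just1 M e x v.
Proof.
  unfold just, ent at 1 2 3 4 5 6 7 8. now rewrite !p1_pair, !p2_pair, !p1_pair.
Qed.

Lemma closed_for_nil X : closed_for X [] 0.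
Proof. intros s sg _ _. exact I. Qed.

Lemma provable_list X x : forall b ys,
  Forall2 (fun g y => forall e, decode e = g -> provable X 0 e x y) (map decode (ldec b)) ys ->
  provable X 1 b x (lenc ys).
Proof.
  induction b as [b IH] using (well_founded_induction lt_wf). intros ys.
  destruct b as [|b].
  - simpl. inversion 1; subst. apply (closed_for_cons X [] 0 0); [apply closed_for_nil|].
    intros s sg _ _. apply just_ent. right. split; [reflexivity|]. left. auto.
  - rewrite ldec_S. simpl. inversion 1 as [|g y gs ys' Hy Hys]; subst.
    destruct (Hy _ eq_refl) as (l1 & s1 & Hl1 & Hin1).
    destruct (IH (p2 b) ltac:(pose proof (p2_le b); lia) _ Hys) as (l2 & s2 & Hl2 & Hin2).
    apply (closed_for_cons X (l1 ++ l2) (s1 + s2) 0); [now apply closed_for_app|].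
    intros s sg _ _. apply just_ent. right. split; [reflexivity|]. right.
    cbn [lenc]. rewrite lhd_lcons, ltl_lcons.
    change (lhd (S b)) with (p1 b). change (ltl (S b)) with (p2 b).
    split; [lia|]. split; [unfold lcons; lia|]. split; apply in_or_app; auto.
Qed.

Lemma eval_provable X k : forall e x v,
  eval k X (decode e) (ldec x) = Some v -> provable X 0 e x v.
Proof.
  induction k as [|k IH]; intros e x v H; [discriminate|].
  rewrite decode_eq in H.
  assert (Hmod : e mod 7 < 7) by (apply Nat.mod_upper_bound; lia).
  destruct (e mod 7) as [|[|[|[|[|[|t]]]]]] eqn:Ht.
  - apply (closed_for_cons X [] 0 0); [apply closed_for_nil|]. intros s sg _ _.
    apply just_ent. left. split; [reflexivity|]. left. simpl in H. split; congruence.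
  - apply (closed_for_cons X [] 0 0); [apply closed_for_nil|]. intros s sg _ _.
    apply just_ent. left. split; [reflexivity|]. right; left. simpl in H.
    rewrite hd_ldec in H. split; congruence.
  - apply (closed_for_cons X [] 0 0); [apply closed_for_nil|]. intros s sg _ _.
    apply just_ent. left. split; [reflexivity|]. right; right; left. cbn [eval] in H.
    rewrite nth_ldec in H. split; congruence.
  - apply (closed_for_cons X [] 0 (S (lhd x))); [apply closed_for_nil|]. intros s sg Hs Ha.
    apply just_ent. left. split; [reflexivity|]. right; right; right; left. cbn [eval] in H.
    rewrite hd_ldec in H. split; [assumption|]. split; [lia|].
    fold (bit sg (lhd x)). rewrite (Ha (lhd x)) by lia.
    destruct (X (lhd x)); [left|right]; split; congruence.
  - apply eval_comp_iff in H. destruct H as (ys & Hys & Hv).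
    rewrite <- (ldec_lenc ys) in Hv. apply IH in Hv.
    assert (Hp : provable X 1 (p2 (e / 7)) x (lenc ys)).
    { apply provable_list. eapply Forall2_impl; [|exact Hys].
      intros g y Hgy e' <-. now apply IH. }
    destruct Hv as (l1 & s1 & Hl1 & Hin1), Hp as (l2 & s2 & Hl2 & Hin2).
    apply (closed_for_cons X (l1 ++ l2) (s1 + s2) (S (lenc ys))); [now apply closed_for_app|].
    intros s sg Hs _. apply just_ent. left. split; [reflexivity|].
    right; right; right; right; left. split; [assumption|].
    exists (lenc ys). repeat split; [lia | apply in_or_app; auto..].
  - apply eval_primrec_iff in H. destruct H as (R & H0 & HR & ->).
    rewrite hd_ldec, tl_ldec in *.
    (* All codes [x'] with the given head and tail are treated, not just [lcons n (ltl x)], since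
       [x] itself may be the code 0 of the empty list. *)
    assert (Hall : forall n x', n <= lhd x -> lhd x' = n -> ltl x' = ltl x ->
              provable X 0 e x' (R n)).
    { induction n as [|n IHn]; intros x' Hn Hh Htl.
      - apply IH in H0. destruct H0 as (l & s0 & Hl & Hin).
        apply (closed_for_cons X l s0 0 _ _ _ _ Hl). intros s sg _ _.
        apply just_ent. left. split; [reflexivity|].
        right; right; right; right; right; left. split; [assumption|]. left.
        rewrite Hh, Htl. auto.
      - destruct (IHn (lcons n (ltl x))) as (l1 & s1 & Hl1 & Hin1);
          [lia | apply lhd_lcons | apply ltl_lcons |].
        specialize (HR n Hn). rewrite <- !ldec_lcons in HR. apply IH in HR.
        destruct HR as (l2 & s2 & Hl2 & Hin2).
        apply (closed_for_cons X (l1 ++ l2) (s1 + s2) (S (R n))); [now apply closed_for_app|].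
        intros s sg Hs _. apply just_ent. left. split; [reflexivity|].
        right; right; right; right; right; left. split; [assumption|]. right.
        rewrite Hh, Htl. split; [lia|].
        exists (R n). repeat split; [lia | apply in_or_app; auto..]. }
    now apply Hall.
  - assert (t = 0) as -> by lia.
    apply eval_mu_iff in H. destruct H as (_ & H0 & Hn).
    rewrite <- ldec_lcons in H0. apply IH in H0. destruct H0 as (l1 & s1 & Hl1 & Hin1).
    assert (Hall : exists l s0, closed_for X l s0 /\ forall n, n < v ->
      exists u, u < s0 /\ In (ent 0 (e / 7) (lcons n x) (S u)) l).
    { clear - Hn IH. induction v as [|v IHv].
      - exists [], 0. split; [apply closed_for_nil | lia].
      - destruct IHv as (l1 & s1 & Hl1 & H1); [intros; apply Hn; lia|].
        destruct (Hn v) as [u Hu]; [lia|]. rewrite <- ldec_lcons in Hu. apply IH in Hu.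
        destruct Hu as (l2 & s2 & Hl2 & H2).
        exists (l1 ++ l2), (s1 + (s2 + S u)). split.
        + intros s sg Hs. apply (closed_for_app X l1 s1 l2 s2); auto. lia.
        + intros n Hlt. destruct (Nat.eq_dec n v) as [->|Hne].
          * exists u. split; [lia|]. apply in_or_app. auto.
          * destruct (H1 n) as (u' & Hu' & Hin); [lia|]. exists u'.
            split; [lia|]. apply in_or_app. auto. }
    destruct Hall as (l2 & s2 & Hl2 & H2).
    apply (closed_for_cons X (l1 ++ l2) (s1 + s2) s2); [now apply closed_for_app|].
    intros s sg Hs _. apply just_ent. left. split; [reflexivity|].
    right; right; right; right; right; right. split; [assumption|].
    split; [apply in_or_app; auto|].
    intros n Hlt. destruct (H2 n Hlt) as (u & Hu & Hin). exists u.
    split; [lia | apply in_or_app; auto].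
Qed.

(** Kleene's normal form: convergence is an unbounded search for one number, each candidate being
    checked with finitely many oracle bits. *)
Lemma computes_within_spec X e x v :
  evals_to X (decode e) (ldec x) v <-> exists s, computes_within (pre X s) s e x v.
Proof.
  split.
  - intros [k Hk]. apply eval_provable in Hk. destruct Hk as (l & s0 & Hl & Hin).
    (* The bound must exceed the code of the derivation as well as its witnesses. *)
    exists (s0 + S (lenc l)), (lenc l). split; [lia|].
    rewrite lclosed_iff, lmem_spec, ldec_lenc. split; [|assumption].
    apply Hl; [lia|]. apply agree_pre.
  - intros (s & d & _ & H1 & H2). rewrite lclosed_iff in H1. rewrite lmem_spec in H2.
    exact (closed_sound X _ _ _ (agree_pre X s) H1 0 e x v H2).
Qed.

Lemma halts_within_spec X e n :
  halts X e n <-> exists s, halts_within (pre X s) s e (lcons n 0).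
Proof.
  split.
  - intros (k & v & Hk).
    assert (H : evals_to X (decode e) (ldec (lcons n 0)) v).
    { exists k. now rewrite ldec_lcons. }
    apply computes_within_spec in H. destruct H as [s H]. exists (s + S v), v. split; [lia|].
    eapply computes_within_mono; [| |exact H]; [lia|].
    eapply agree_trans; [apply agree_pre|]. apply agree_sym.
    eapply agree_le; [|apply agree_pre]. lia.
  - intros (s & v & _ & H).
    destruct (proj2 (computes_within_spec X e (lcons n 0) v)) as [k Hk]; [eauto|].
    exists k, v. now rewrite ldec_lcons in Hk.
Qed.

Ltac rec_programs ::=
  lazymatch goal with
  | |- rec _ (fun v => pre _ _) => apply rec_pre
  | |- dec _ (fun v => bit _ _ = true) => apply dec_bit
  | |- dec _ (fun v => computes_within _ _ _ _ _) => apply dec_computes_within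
  | |- dec _ (fun v => halts_within _ _ _ _) => apply dec_halts_within
  end.

(** * Jumps and Turing reducibility *)

Definition chi (A : nat -> Prop) (n : nat) : bool :=
  if excluded_middle_informative (A n) then true else false.

Lemma chi_spec A n : chi A n = true <-> A n.
Proof. unfold chi. destruct excluded_middle_informative; split; congruence. Qed.

Lemma is_char_chi f A : is_char f A <-> f = chi A.
Proof.
  split.
  - intros H. apply functional_extensionality. intros n.
    apply eq_true_iff_eq. now rewrite chi_spec.
  - intros ->. intros n. apply chi_spec.
Qed.

Lemma chi_ext A B : (forall n, A n <-> B n) -> chi A = chi B.
Proof. intros H. apply is_char_chi. intros n. rewrite chi_spec. apply H. Qed.

Definition jmp (X : nat -> bool) : nat -> bool := chi (fun e => halts X e e).

(** [jump] quantifies over characteristic functions of [A]; by extensionality [chi A] is the only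
    one. *)
Lemma chi_jump A : chi (jump A) = jmp (chi A).
Proof.
  apply chi_ext. intros e. split.
  - intros (f & Hf & H). apply is_char_chi in Hf. now subst f.
  - intros H. exists (chi A). split; [now apply is_char_chi | exact H].
Qed.

Definition Turing_le (X Y : nat -> bool) : Prop := dec Y (fun v => X (nth 0 v 0) = true).

Lemma rec_Turing_le X Y f : Turing_le X Y -> rec X f -> rec Y f.
Proof.
  intros HXY [c Hc].
  destruct (rec_ite Y _ (fun _ => 1) (fun _ => 0) HXY (rec_const Y 1) (rec_const Y 0)) as [d Hd].
  exists (oracle_subst d c). intros v. destruct (Hc v) as [k Hk].
  eapply evals_to_oracle_subst; [|exact Hk]. intros n. specialize (Hd [n]). simpl in Hd.
  destruct (X n); [rewrite ite_true in Hd by reflexivity | rewrite ite_false in Hd by discriminate];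
    exact Hd.
Qed.

Lemma dec_Turing_le X Y P : Turing_le X Y -> dec X P -> dec Y P.
Proof. intros H (f & Hf & HP). exists f. split; [eapply rec_Turing_le; eauto | exact HP]. Qed.

Lemma Turing_le_trans X Y Z : Turing_le X Y -> Turing_le Y Z -> Turing_le X Z.
Proof. intros H H'. eapply dec_Turing_le; eauto. Qed.

Lemma dec_app1 Y (P : nat -> Prop) f : dec Y (fun v => P (nth 0 v 0)) -> rec Y f ->
  dec Y (fun v => P (f v)).
Proof.
  intros HP Hf. apply (dec_subst Y _ (fun v => [f v]) HP).
  intros [|[|i]]; simpl; auto using rec_const.
Qed.

Lemma Turing_red_iff A B :
  Turing_red A B <-> dec (chi B) (fun v => A (nth 0 v 0)).
Proof.
  split.
  - intros [e He]. exists (fun v => ite (A (nth 0 v 0)) 0 1). split.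
    (* [Turing_red] answers 1 for members where [dec] wants 0, so the output of the given program is
       subtracted from 1. *)
    + apply rec_ext with (fun v => 1 - (1 - ite (A (nth 0 v 0)) 0 1)).
      { intros v. unfold ite. destruct excluded_middle_informative; reflexivity. }
      apply rec_sub; [apply rec_const|].
      apply (rec_comp1 (chi B) (decode e) _ (fun n => 1 - ite (A n) 0 1)); [|apply rec_nth].
      intros n. destruct (He (chi B) (proj2 (is_char_chi _ _) eq_refl) n) as [k [[Hk HA]|[Hk HA]]].
      * exists k. now rewrite ite_true.
      * exists k. now rewrite ite_false.
    + intros v. unfold ite. destruct excluded_middle_informative; split; congruence.
  - intros HA.
    destruct (rec_ite _ _ (fun _ => 1) (fun _ => 0) HA (rec_const _ 1) (rec_const _ 0)) as [c Hc].
    exists (encode c). intros f Hf n. apply is_char_chi in Hf. subst f.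
    rewrite decode_encode. destruct (Hc [n]) as [k Hk]. exists k. simpl in Hk.
    destruct (classic (A n)) as [H|H].
    + left. now rewrite ite_true in Hk.
    + right. now rewrite ite_false in Hk.
Qed.

Lemma exists_least (P : nat -> Prop) :
  (exists n, P n) -> exists n, P n /\ forall m, m < n -> ~ P m.
Proof.
  intros [n Hn]. revert Hn. induction n as [n IH] using (well_founded_induction lt_wf).
  intros Hn. destruct (classic (exists m, m < n /\ P m)) as [(m & Hm & H)|H].
  - exact (IH m Hm H).
  - exists n. split; [assumption|]. intros m Hm Hp. apply H. eauto.
Qed.

Definition least (P : nat -> Prop) : nat :=
  epsilon (inhabits 0) (fun n => P n /\ forall m, m < n -> ~ P m).

Lemma least_spec (P : nat -> Prop) : (exists n, P n) -> P (least P).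
Proof.
  intros H. apply exists_least in H.
  exact (proj1 (epsilon_spec (inhabits 0) _ H)).
Qed.

Lemma rec_mu X (P : list nat -> nat -> Prop) :
  dec X (fun w => P (tl w) (nth 0 w 0)) -> (forall v, exists n, P v n) ->
  rec X (fun v => least (P v)).
Proof.
  intros HP Hex. apply rec_least with (fun n v => P v n); [exact HP|].
  intros v. apply (epsilon_spec (inhabits 0) (fun n => P v n /\ forall m, m < n -> ~ P v m)).
  apply exists_least, Hex.
Qed.

(** * Sigma^0_1 sets and the jump *)

Definition sigma1 (X : nat -> bool) (A : nat -> Prop) : Prop :=
  exists P : nat -> nat -> Prop,
    dec X (fun v => P (nth 0 v 0) (nth 1 v 0)) /\ forall n, A n <-> exists s, P s n.

Fixpoint const_code (n : nat) : code :=
  match n with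
  | 0 => CZero
  | S n => CComp CSucc [const_code n]
  end.

Lemma evals_to_const X n xs : evals_to X (const_code n) xs n.
Proof.
  induction n as [|n IH].
  - exists 1. reflexivity.
  - apply evals_to_comp with [n]; [auto|]. exists 1. reflexivity.
Qed.

Lemma rec_encode_const X f : rec X f -> rec X (fun v => encode (const_code (f v))).
Proof.
  intros Hf.
  (* Here 4 is the tag of [CComp] and the inner 1 is the code of [CSucc]. *)
  apply rec_ext with (fun v => nat_rect (fun _ => nat) 0
    (fun _ r => 4 + to_nat (1, lcons r 0) * 7) (f v)).
  - intros v. induction (f v) as [|n IH]; [reflexivity|].
    cbn [nat_rect]. now rewrite IH.
  - rsolve.
Qed.

(** The s-m-n theorem in miniature: [n] is hard-wired by [const_code], so the search program ignores
    its input and halts on its own index exactly when [A n] holds. *)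
Lemma sigma1_dec_jmp X A f : sigma1 X A -> rec (jmp X) f -> dec (jmp X) (fun v => A (f v)).
Proof.
  intros (P & (d & [c Hc] & HP) & HA) Hf.
  pose (g n := encode (CComp (CMu c) [const_code n])).
  apply dec_ext with (fun v => jmp X (g (f v)) = true).
  - intros v. generalize (f v) as n. intros n. unfold jmp. rewrite chi_spec, HA.
    unfold halts, g. rewrite decode_encode. split.
    + intros (k & y & Hk). destruct k as [|k]; [discriminate|].
      apply eval_comp_iff in Hk. destruct Hk as (ys & Hys & Hk).
      inversion Hys as [|? z ? ? Hz Hnil]; subst. inversion Hnil; subst.
      assert (z = n) as -> by (eapply evals_to_fun; [exists k; exact Hz | apply evals_to_const]).
      destruct k as [|k]; [discriminate|].
      apply eval_mu_iff in Hk. destruct Hk as (_ & Hk & _).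
      exists y. apply (HP [y; n]). eapply evals_to_fun; [apply Hc|]. exists k. exact Hk.
    + intros H. apply exists_least in H. destruct H as (s & Hs & Hlt).
      assert (H : evals_to X (CComp (CMu c) [const_code n])
                [encode (CComp (CMu c) [const_code n])] s).
      { eapply evals_to_comp.
        - constructor; [apply evals_to_const | constructor].
        - apply evals_to_mu.
          + apply (HP [s; n]) in Hs. rewrite <- Hs. apply Hc.
          + intros m Hm. exists (pred (d [m; n])).
            rewrite Nat.succ_pred; [apply Hc|]. intros H.
            apply (HP [m; n]) in H. exact (Hlt m Hm H). }
      destruct H as [k Hk]. eauto.
  - apply dec_oracle. unfold g. cbn [encode map lenc].
    rsolve. now apply rec_encode_const.
Qed.

Lemma sigma1_halts X : sigma1 X (fun e => halts X e e).
Proof.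
  exists (fun s e => halts_within (pre X s) s e (lcons e 0)). split.
  - rsolve. apply dec_oracle. rsolve.
  - intros e. apply halts_within_spec.
Qed.

Lemma sigma1_of_dec X (A : nat -> Prop) : dec X (fun v => A (nth 0 v 0)) -> sigma1 X A.
Proof.
  intros H. exists (fun _ n => A n). split.
  - apply (dec_app1 X A); [exact H | rsolve].
  - intros n. split; [intros HA; now exists 0 | now intros []].
Qed.

Lemma Turing_le_jmp X : Turing_le X (jmp X).
Proof.
  apply (sigma1_dec_jmp X (fun n => X n = true)); [|apply rec_nth].
  apply sigma1_of_dec, dec_oracle, rec_nth.
Qed.

Lemma jmp_mono X Y : Turing_le X Y -> Turing_le (jmp X) (jmp Y).
Proof.
  intros H. destruct (sigma1_halts X) as (P & HP & HA).
  apply dec_ext with (fun v => halts X (nth 0 v 0) (nth 0 v 0)).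
  - intros v. unfold jmp. now rewrite chi_spec.
  - apply (sigma1_dec_jmp Y (fun e => halts X e e)); [|apply rec_nth].
    exists P. split; [eapply dec_Turing_le; eauto | exact HA].
Qed.

(** * The low basis theorem *)

Definition upd (X : nat -> bool) (s : nat) (b : bool) (i : nat) : bool :=
  if Nat.eq_dec i s then b else X i.

(** Compactness of Cantor space. Decreasing sets, the [t]-th determined by the first [t] bits, stand
    for the levels of a binary tree. *)
Lemma koenig (P : nat -> (nat -> bool) -> Prop) :
  (forall t X Y, agree t X Y -> P t X -> P t Y) ->
  (forall t X, P (S t) X -> P t X) ->
  (forall t, exists X, P t X) -> exists Z, forall t, P t Z.
Proof.
  intros Hloc Hanti Hex.
  assert (Hle : forall t t' X, t <= t' -> P t' X -> P t X) by
    (intros t t' X Hle; induction Hle; auto).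
  pose (ext s X := forall t, exists Z, agree s X Z /\ P t Z).
  assert (Hstep : forall s X, ext s X -> ext (S s) (upd X s true) \/ ext (S s) (upd X s false)).
  { intros s X HX. apply NNPP. intros H. apply not_or_and in H. destruct H as [H1 H2].
    apply not_all_ex_not in H1, H2. destruct H1 as [t1 H1], H2 as [t2 H2].
    (* If both one-bit extensions die, at [t1] and at [t2], an element surviving to [t1 + t2]
       continues along one of them, a contradiction. *)
    destruct (HX (t1 + t2)) as (Z & HZ & HP).
    assert (Ha : agree (S s) (upd X s (Z s)) Z).
    { intros i Hi. unfold upd. destruct (Nat.eq_dec i s) as [->|]; [reflexivity|].
      apply HZ. lia. }
    destruct (Z s); [apply H1 | apply H2]; exists Z; (split; [exact Ha|]);
      (eapply Hle; [|exact HP]; lia). }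
  pose (next s X := if excluded_middle_informative (ext (S s) (upd X s true))
                    then upd X s true else upd X s false).
  pose (seqX := nat_rect (fun _ => nat -> bool) (fun _ => false) next).
  assert (Hext : forall s, ext s (seqX s)).
  { induction s as [|s IH].
    - intros t. destruct (Hex t) as [Z HZ]. exists Z. split; [intros i Hi; lia | exact HZ].
    - simpl. fold (seqX s). unfold next. destruct excluded_middle_informative as [H|H]; [exact H|].
      destruct (Hstep s _ IH); tauto. }
  assert (Hnext : forall s X, agree s (next s X) X).
  { intros s X i Hi. unfold next, upd.
    destruct excluded_middle_informative, (Nat.eq_dec i s); auto; lia. }
  assert (Hag : forall s t, s <= t -> agree s (seqX s) (seqX t)).
  { intros s t Hst. induction Hst as [|t Hst IH]; [intros i _; reflexivity|].
    eapply agree_trans; [exact IH|]. simpl. apply agree_sym.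
    eapply agree_le; [exact Hst | apply Hnext]. }
  exists (fun i => seqX (S i) i). intros t.
  destruct (Hext t t) as (Z & HZ & HP). apply (Hloc t Z); [|exact HP].
  intros i Hi. rewrite <- HZ by assumption. symmetry. apply (Hag (S i) t); lia.
Qed.

(** Forcing with Pi^0_1 classes. [Bad u] reads only [b u] bits and is decidable in [A] on strings,
    so avoiding all [Bad u] is a Pi^0_1(A) class. Each bit of the jump is settled by asking whether
    a subclass is empty, which by compactness is Sigma^0_1(A). *)
Lemma low_basis A (Bad : nat -> (nat -> bool) -> Prop) (b : nat -> nat) :
  (forall f, rec A f -> rec A (fun v => b (f v))) ->
  (forall f g, rec A f -> rec A g -> dec A (fun v => Bad (f v) (bit (g v)))) ->
  (forall u X Y, agree (b u) X Y -> Bad u X -> Bad u Y) ->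
  (exists Z, forall u, ~ Bad u Z) ->
  exists Z, (forall u, ~ Bad u Z) /\ Turing_le (jmp Z) (jmp A).
Proof.
  intros Hb HBad Hloc Hex.
  (* The zeros of [be] below [e] are the programs forced to diverge. [Cls e be] is the resulting
     subclass, and [ok t] is the part of its definition already settled by the first [t] bits. *)
  pose (ok t e be Z :=
    ball t (fun u => b u <= t -> ~ Bad u Z) /\
    ball e (fun j => ~ bit be j = true -> ~ halts_within (pre Z t) t j (lcons j 0))).
  pose (Cls e be Z :=
    (forall u, ~ Bad u Z) /\ forall j, j < e -> ~ bit be j = true -> ~ halts Z j j).
  assert (Hhlt : forall t t' X Y j, t <= t' -> agree t X Y ->
            halts_within (pre X t) t j (lcons j 0) -> halts_within (pre Y t') t' j (lcons j 0)).
  { intros t t' X Y j Ht Ha. apply halts_within_mono; [assumption|].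
    eapply agree_trans; [apply agree_pre|]. eapply agree_trans; [exact Ha|].
    apply agree_sym. eapply agree_le; [exact Ht | apply agree_pre]. }
  assert (okloc : forall t e be X Y, agree t X Y -> ok t e be X -> ok t e be Y).
  { intros t e be X Y Ha [H1 H2]. split.
    - intros u Hu Hbu HB. apply (H1 u Hu Hbu). eapply Hloc; [|exact HB].
      apply agree_sym. eapply agree_le; eauto.
    - intros j Hj Hbit H. apply (H2 j Hj Hbit). eapply Hhlt; [| |exact H]; auto using agree_sym. }
  assert (okanti : forall t e be X, ok (S t) e be X -> ok t e be X).
  { intros t e be X [H1 H2]. split.
    - intros u Hu Hbu. apply H1; lia.
    - intros j Hj Hbit H. apply (H2 j Hj Hbit). eapply Hhlt; [| |exact H]; [lia|].
      intros i _. reflexivity. }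
  assert (okCls : forall e be Z, (forall t, ok t e be Z) <-> Cls e be Z).
  { intros e be Z. split.
    - intros H. split.
      + intros u. apply (proj1 (H (S u + b u)) u); lia.
      + intros j Hj Hbit Hh. apply halts_within_spec in Hh. destruct Hh as [t Ht].
        exact (proj2 (H t) j Hj Hbit Ht).
    - intros [H1 H2] t. split; [intros u _ _; apply H1|].
      intros j Hj Hbit Hh. apply (H2 j Hj Hbit). apply halts_within_spec. eauto. }
  (* Emptiness is expressed by a level of the tree without nodes, which makes it an existential
     statement. *)
  pose (Empty e be := exists t, ball (2 ^ t) (fun sg => ~ ok t e be (bit sg))).
  assert (HEmpty : forall e be, ~ Empty e be -> exists Z, Cls e be Z).
  { intros e be H. destruct (koenig (fun t Z => ok t e be Z)) as [Z HZ]; eauto.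
    - intros t. apply NNPP. intros Ht. apply H. exists t. intros sg _ Hok. apply Ht. eauto.
    - exists Z. now apply okCls. }
  (* Bit [e] of [beta (S e)] is 0 iff the class can be shrunk so that [e] is not in the jump. *)
  pose (beta := nat_rect (fun _ => nat) 0
                 (fun e r => ite (Empty (S e) r) (r + 2 ^ e) r)).
  assert (Hbeta_S : forall e, beta (S e) = ite (Empty (S e) (beta e)) (beta e + 2 ^ e) (beta e))
    by reflexivity.
  assert (Hbeta_lt : forall e, beta e < 2 ^ e).
  { induction e as [|e IH]; [simpl; lia|]. rewrite Hbeta_S. simpl.
    unfold ite. destruct excluded_middle_informative; lia. }
  assert (Hbit_S : forall e j, j < e -> bit (beta (S e)) j = bit (beta e) j).
  { intros e j Hj. rewrite Hbeta_S. unfold ite.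
    destruct excluded_middle_informative; [now apply bit_add_pow_lt | reflexivity]. }
  assert (Hbit : forall e e' j, j < e -> e <= e' -> bit (beta e') j = bit (beta e) j).
  { intros e e' j Hj He. induction He as [|e' He IH]; [reflexivity|].
    rewrite Hbit_S by lia. exact IH. }
  assert (Hinh : forall e, exists Z, Cls e (beta e) Z).
  { induction e as [|e [Z [HZ1 HZ2]]].
    - destruct Hex as [Z HZ]. exists Z. split; [exact HZ | lia].
    - destruct (classic (Empty (S e) (beta e))) as [HE|HE].
      + exists Z. split; [exact HZ1|]. intros j Hj Hn.
        destruct (Nat.eq_dec j e) as [->|Hne].
        * exfalso. apply Hn. rewrite Hbeta_S, ite_true by assumption.
          now apply bit_add_pow_eq.
        * apply HZ2; [lia|]. rewrite Hbit_S in Hn by lia. exact Hn.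
      + destruct (HEmpty _ _ HE) as [Z' HZ']. exists Z'.
        now rewrite Hbeta_S, ite_false. }
  (* Running along the diagonal [e = t] puts [Z] into all the shrinking classes at once. *)
  destruct (koenig (fun t Z => ok t t (beta t) Z)) as [Z HZ].
  - intros t X Y. apply okloc.
  - intros t X H. apply okanti. destruct H as [H1 H2]. split; [exact H1|].
    intros j Hj Hn. apply H2; [lia|]. rewrite Hbit_S by assumption. exact Hn.
  - intros t. destruct (Hinh t) as [Z HZ]. exists Z. now apply okCls.
  - assert (HB : forall u, ~ Bad u Z).
    { intros u. apply (proj1 (HZ (S u + b u)) u); lia. }
    assert (Hneg : forall e, ~ bit (beta (S e)) e = true -> ~ halts Z e e).
    { intros e Hn Hh. apply halts_within_spec in Hh. destruct Hh as [t Ht].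
      apply (proj2 (HZ (S e + t)) e); [lia| |].
      - rewrite (Hbit (S e)) by lia. exact Hn.
      - eapply Hhlt; [| |exact Ht]; [lia|]. intros i _. reflexivity. }
    exists Z. split; [exact HB|].
    apply dec_ext with (fun v => bit (beta (S (nth 0 v 0))) (nth 0 v 0) = true).
    + intros v. generalize (nth 0 v 0) as e. intros e. unfold jmp. rewrite chi_spec.
      split; [|intros Hh; apply NNPP; intros Hn; exact (Hneg e Hn Hh)].
      (* If the subclass is empty, [e] must halt, as otherwise [Z] would belong to it. If it is
         nonempty, bit [e] was left at 0, against [Hbe]. *)
      intros Hbe. destruct (classic (Empty (S e) (beta e))) as [[t Ht]|HE].
      * apply NNPP. intros Hnh. apply (Ht (pre Z t) (pre_lt Z t)).
        apply (okloc t (S e) (beta e) Z); [apply agree_sym, agree_pre|]. revert t Ht.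
        enough (Cls (S e) (beta e) Z) as HC by (intros t _; now apply okCls).
        split; [exact HB|]. intros j Hj Hn. destruct (Nat.eq_dec j e) as [->|Hne]; [exact Hnh|].
        apply Hneg. rewrite <- (Hbit (S j) e) by lia. exact Hn.
      * rewrite Hbeta_S, ite_false in Hbe by assumption.
        rewrite (bit_small _ e) in Hbe; [discriminate | apply Hbeta_lt | lia].
    + assert (Hdec : forall f g, rec (jmp A) f -> rec (jmp A) g ->
                dec (jmp A) (fun v => Empty (f v) (g v))).
      { intros f g Hf Hg.
        apply dec_ext with (fun v => Empty (p1 (to_nat (f v, g v))) (p2 (to_nat (f v, g v)))).
        { intros v. now rewrite p1_pair, p2_pair. }
        apply (sigma1_dec_jmp A (fun n => Empty (p1 n) (p2 n))); [|rsolve].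
        exists (fun t n => ball (2 ^ t) (fun sg => ~ ok t (p1 n) (p2 n) (bit sg))).
        split; [|reflexivity]. unfold ok. rsolve.
        - apply Hb. rsolve.
        - apply HBad; rsolve. }
      apply dec_bit; [|rsolve]. unfold beta. rsolve. apply Hdec; rsolve.
Qed.

(** * A uniform sequence of total tournaments *)

Definition oempty : nat -> bool := fun _ => false.

Lemma bit_0 i : bit 0 i = false.
Proof. apply Nat.bits_0. Qed.

Lemma computes_within_0_spec e x v :
  evals_to oempty (decode e) (ldec x) v <-> exists s, computes_within 0 s e x v.
Proof.
  rewrite computes_within_spec. split; intros [s H]; exists s; (eapply computes_within_mono; [apply le_n| |exact H]).
  - intros i Hi. rewrite bit_0. now apply bit_pre.
  - intros i Hi. rewrite bit_0. symmetry. now apply bit_pre.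
Qed.

Lemma computes_within_0_mono s t e x v : s <= t -> computes_within 0 s e x v -> computes_within 0 t e x v.
Proof. intros Hst. apply computes_within_mono; [assumption|]. intros i _. reflexivity. Qed.

(** A vertex is released only after the edge program has answered on all pairs [(x, d)] with
    [x <= d]. Between two released vertices the smaller one can thus be put first and the answer is
    known. *)
Definition good (i d s : nat) : Prop :=
  computes_within 0 s (p1 i) (lcons d 0) 1 /\
  ball (S d) (fun x => bex s (fun v => computes_within 0 s (p2 i) (lcons x (lcons d 0)) v)).

Definition last_good (i s d : nat) : Prop :=
  d < s /\ good i d s /\ ball s (fun d' => good i d' s -> d' <= d).

(** The formula is vacuously true if a stage has no vertex yet or both have the same one; this
    default concerns no edge of the original tournament. *)
Definition edge_lt (i s t : nat) : Prop :=
  ball s (fun u => ball t (fun w => last_good i s u -> last_good i t w -> ~ u = w ->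
    computes_within 0 t (p2 i) (lcons u (lcons w 0)) 1)).

(* Vertex [s] stands for the [d] with [last_good i s d], which makes the tournament total even if
   the programs coded by [i] are partial. *)
Definition edge (i s t : nat) : Prop :=
  s < t /\ edge_lt i s t \/ t < s /\ ~ edge_lt i t s.

Lemma dec_good X f g h : rec X f -> rec X g -> rec X h ->
  dec X (fun v => good (f v) (g v) (h v)).
Proof. intros. unfold good. rsolve. Qed.

Lemma dec_last_good X f g h : rec X f -> rec X g -> rec X h ->
  dec X (fun v => last_good (f v) (g v) (h v)).
Proof. intros. unfold last_good. rsolve; apply dec_good; rsolve. Qed.

Lemma dec_edge X f g h : rec X f -> rec X g -> rec X h ->
  dec X (fun v => edge (f v) (g v) (h v)).
Proof. intros. unfold edge, edge_lt. rsolve; apply dec_last_good; rsolve. Qed.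

Lemma edge_irrefl i s : ~ edge i s s.
Proof. unfold edge. lia. Qed.

Lemma edge_antisym i s t : s <> t -> (edge i s t <-> ~ edge i t s).
Proof.
  intros Hne. unfold edge. destruct (Nat.lt_total s t) as [H|[H|H]]; [|contradiction|].
  - assert (~ t < s) by lia. tauto.
  - assert (~ s < t) by lia. destruct (classic (edge_lt i t s)); tauto.
Qed.

Lemma good_mono i d s t : s <= t -> good i d s -> good i d t.
Proof.
  intros Hst [H1 H2]. split; [eapply computes_within_0_mono; eauto|].
  intros x Hx. destruct (H2 x Hx) as (v & Hv & H). exists v. split; [lia|].
  eapply computes_within_0_mono; eauto.
Qed.

Lemma last_good_mono i s t u w : s <= t -> last_good i s u -> last_good i t w -> u <= w.
Proof.
  intros Hst (H1 & H2 & _) (_ & _ & H3). apply H3; [lia|]. eapply good_mono; eauto.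
Qed.

Lemma last_good_unique i s u w : last_good i s u -> last_good i s w -> u = w.
Proof.
  intros Hu Hw. apply Nat.le_antisymm.
  - exact (last_good_mono i s s u w (le_n s) Hu Hw).
  - exact (last_good_mono i s s w u (le_n s) Hw Hu).
Qed.

Lemma last_good_exists i s d : d < s -> good i d s -> exists w, d <= w /\ last_good i s w.
Proof.
  intros Hd Hg.
  destruct (exists_least (fun k => k < s /\ good i (s - S k) s)) as (k & [Hk1 Hk2] & Hk3).
  { exists (s - S d). replace (s - S (s - S d)) with d by lia. split; [lia|assumption]. }
  assert (Hmax : forall d', d' < s -> good i d' s -> d' <= s - S k).
  { intros d' Hd' Hg'. apply Nat.nlt_ge. intros Hlt. apply (Hk3 (s - S d')); [lia|].
    split; [lia|]. now replace (s - S (s - S d')) with d' by lia. }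
  exists (s - S k). split; [now apply Hmax|]. split; [lia|]. split; [assumption | exact Hmax].
Qed.

(** The index pairs a program for [D] with one for [T]. The stages form a blow-up of the tournament
    in which consecutive stages may repeat a vertex; since [D] is infinite the vertices still grow
    beyond any bound. *)
Lemma tournament_index D T :
  infinite D -> tournament D T -> computable D -> computable2 T ->
  exists i, (forall s d, last_good i s d -> D d) /\
    (forall s t u w, last_good i s u -> last_good i t w -> u <> w -> (edge i s t <-> T u w)) /\
    (forall d, exists s0, forall s, s0 <= s -> exists w, d < w /\ last_good i s w).
Proof.
  intros Hinf (HTD & HTirr & HTtot) [a Ha] [b Hb].
  exists (to_nat (a, b)). set (i := to_nat (a, b)).
  assert (Hi1 : p1 i = a) by apply p1_pair. assert (Hi2 : p2 i = b) by apply p2_pair.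
  specialize (Ha oempty). assert (Hc : is_char oempty empty_set).
  { intros n. unfold oempty, empty_set. split; [discriminate | tauto]. }
  specialize (Ha Hc).
  assert (HaD : forall s d, computes_within 0 s a (lcons d 0) 1 -> D d).
  { intros s d H. assert (H' : exists s, computes_within 0 s a (lcons d 0) 1) by eauto.
    apply computes_within_0_spec in H'. rewrite ldec_lcons in H'. change (ldec 0) with (@nil nat) in H'.
    destruct (Ha d) as [k [[Hk Hd]|[Hk Hd]]]; [exact Hd|].
    exfalso. enough (1 = 0) by lia. eapply evals_to_fun; [exact H'|]. now exists k. }
  assert (HbT : forall s u w v, computes_within 0 s b (lcons u (lcons w 0)) v -> (v = 1 <-> T u w)).
  { intros s u w v H. assert (H' : exists s, computes_within 0 s b (lcons u (lcons w 0)) v) by eauto.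
    apply computes_within_0_spec in H'. rewrite !ldec_lcons in H'. change (ldec 0) with (@nil nat) in H'.
    destruct (Hb u w) as [k [[Hk Hd]|[Hk Hd]]].
    - assert (v = 1) by (eapply evals_to_fun; [exact H'|]; now exists k). tauto.
    - assert (v = 0) by (eapply evals_to_fun; [exact H'|]; now exists k).
      split; [lia | tauto]. }
  assert (HD : forall s d, last_good i s d -> D d).
  { intros s d (_ & [H _] & _). rewrite Hi1 in H. eauto. }
  assert (Hlt : forall s t u w, s < t -> last_good i s u -> last_good i t w -> u <> w ->
            (edge_lt i s t <-> T u w)).
  (* By [u <= w], the release of [w] guarantees an answer on the pair [(u, w)]. *)
  { intros s t u w Hst Hu Hw Hne. pose proof (last_good_mono i s t u w ltac:(lia) Hu Hw) as Huw.
    pose proof Hu as (Hus & _). pose proof Hw as (Hwt & [_ Hconv] & _).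
    destruct (Hconv u ltac:(lia)) as (v & _ & Hv). rewrite Hi2 in Hv.
    split.
    - intros He. specialize (He u Hus w Hwt Hu Hw Hne). rewrite Hi2 in He.
      exact (proj1 (HbT _ _ _ _ He) eq_refl).
    - intros HT u' Hu' w' Hw' Hlu Hlw _.
      rewrite (last_good_unique i s u' u Hlu Hu), (last_good_unique i t w' w Hlw Hw). rewrite Hi2. apply (HbT _ _ _ _ Hv) in HT. now subst v. }
  split; [exact HD|]. split.
  - intros s t u w Hu Hw Hne. unfold edge. destruct (Nat.lt_total s t) as [H|[->|H]].
    + rewrite (Hlt s t u w H Hu Hw Hne). assert (~ t < s) by lia. tauto.
    + exfalso. apply Hne. exact (last_good_unique i t u w Hu Hw).
    + assert (Hne' : w <> u) by auto. rewrite (Hlt t s w u H Hw Hu Hne').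
      assert (~ s < t) by lia.
      destruct (HTtot u w (HD _ _ Hu) (HD _ _ Hw) Hne). tauto.
  - intros d. destruct (Hinf (S d)) as (d' & Hd' & HDd').
    assert (Hg : exists s0, good i d' s0).
    { destruct (Ha d') as [k [[Hk _]|[_ Hk]]]; [|contradiction].
      assert (H1 : exists s, computes_within 0 s a (lcons d' 0) 1).
      { apply computes_within_0_spec. rewrite ldec_lcons. now exists k. }
      destruct H1 as [s1 H1].
      assert (H2 : forall n, exists s, ball n (fun x => bex s (fun v =>
                computes_within 0 s b (lcons x (lcons d' 0)) v))).
      { induction n as [|n [s2 IH]]; [exists 0; intros x Hx; lia|].
        assert (H2 : exists v s, computes_within 0 s b (lcons n (lcons d' 0)) v).
        { destruct (Hb n d') as [k' [[Hk' _]|[Hk' _]]];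
            [exists 1 | exists 0]; apply computes_within_0_spec; rewrite !ldec_lcons; now exists k'. }
        destruct H2 as (v & s3 & H3). exists (s2 + s3 + S v). intros x Hx.
        destruct (Nat.eq_dec x n) as [->|Hne].
        - exists v. split; [lia|]. eapply computes_within_0_mono; [|exact H3]. lia.
        - destruct (IH x ltac:(lia)) as (v' & Hv' & H'). exists v'. split; [lia|].
          eapply computes_within_0_mono; [|exact H']. lia. }
      destruct (H2 (S d')) as [s2 H2']. exists (s1 + s2). split.
      - rewrite Hi1. eapply computes_within_0_mono; [|exact H1]. lia.
      - intros x Hx. destruct (H2' x Hx) as (v & Hv & H). exists v. split; [lia|].
        rewrite Hi2. eapply computes_within_0_mono; [|exact H]. lia. }
    destruct Hg as [s0 Hg]. exists (S d' + s0). intros s Hs.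
    destruct (last_good_exists i s d') as (w & Hw & Hlg); [lia|eapply good_mono; [|exact Hg]; lia|].
    exists w. split; [lia | exact Hlg].
Qed.

(** The subtournament is the image of a tail of [G] under the map from stages to vertices. This map
    is monotone and unbounded on [G], which makes the image decidable in [G] rather than merely
    enumerable. *)
Lemma transitive_subset_of_eventually_transitive G D T :
  infinite D -> tournament D T -> computable D -> computable2 T -> infinite G ->
  (forall i, exists m, forall x y z, m <= x -> m <= y -> m <= z ->
     G x -> G y -> G z -> edge i x y -> edge i y z -> edge i x z) ->
  exists H : nat -> Prop, transitive_subset D T H /\ infinite H /\ Turing_red H G.
Proof.
  intros HinfD HT HcD HcT HinfG Htr.
  destruct (tournament_index D T HinfD HT HcD HcT) as (i & HD & HE & Hunb).
  destruct HT as (_ & HTirr & HTtot). destruct (Htr i) as [m Hm].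
  assert (Hnext : forall d, exists s, m <= s /\ G s /\ exists w, d < w /\ last_good i s w).
  { intros d. destruct (Hunb d) as [s0 Hs0]. destruct (HinfG (m + s0)) as (s & Hs & HG).
    exists s. split; [lia|]. split; [exact HG|]. apply Hs0. lia. }
  exists (fun d => exists s, m <= s /\ G s /\ last_good i s d). split; [split|split].
  - intros d (s & _ & _ & H). eauto.
  - intros x y z (sx & Hx & Gx & Lx) (sy & Hy & Gy & Ly) (sz & Hz & Gz & Lz) Txy Tyz.
    assert (Hxy : x <> y) by (intros ->; exact (HTirr _ Txy)).
    assert (Hyz : y <> z) by (intros ->; exact (HTirr _ Tyz)).
    assert (Hxz : x <> z).
    { intros ->. destruct (HTtot z y (HD _ _ Lz) (HD _ _ Ly) Hxy). tauto. }
    apply (HE sx sz); auto. apply (Hm sx sy sz); auto; [apply (HE sx sy x y) | apply (HE sy sz y z)]; auto.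
  - intros n. destruct (Hnext n) as (s & Hs & HG & w & Hw & L). exists w. split; [lia|]. eauto.
  - apply Turing_red_iff.
    (* Once some stage in [G] has a vertex beyond the queried number, monotonicity excludes all
       later stages. *)
    pose (P v s := m <= s /\ chi G s = true /\ bex s (fun w => nth 0 v 0 < w /\ last_good i s w)).
    assert (Hg : rec (chi G) (fun v => least (P v))).
    { apply rec_mu.
      - unfold P. rsolve; [apply dec_oracle; rsolve | apply dec_last_good; rsolve].
      - intros v. destruct (Hnext (nth 0 v 0)) as (s & Hs & HG & w & Hw & L). exists s.
        split; [exact Hs|]. split; [now apply chi_spec|]. exists w.
        split; [destruct L; assumption | auto]. }
    apply dec_ext with (fun v => bex (least (P v))
      (fun s => m <= s /\ chi G s = true /\ last_good i s (nth 0 v 0))).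
    + intros v. split.
      * intros (s & _ & Hs & HG & L). apply chi_spec in HG. eauto.
      * intros (s & Hs & HG & L).
        assert (Hl : P v (least (P v))).
        { apply least_spec. destruct (Hnext (nth 0 v 0)) as (s' & Hs' & HG' & w & Hw & L').
          exists s'. split; [exact Hs'|]. split; [now apply chi_spec|]. exists w.
          split; [destruct L'; assumption | auto]. }
        destruct Hl as (_ & _ & w & _ & Hw & L'). exists s. split.
        -- apply Nat.nle_gt. intros Hle. pose proof (last_good_mono _ _ _ _ _ Hle L' L). lia.
        -- split; [exact Hs|]. split; [now apply chi_spec | exact L].
    + rsolve; [apply dec_oracle; rsolve | apply dec_last_good; rsolve].
Qed.

(** * Conditions *)

Lemma pair_mono a b a' b' : a <= a' -> b <= b' -> to_nat (a, b) <= to_nat (a', b').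
Proof.
  intros Ha Hb. pose proof (to_nat_spec a b). pose proof (to_nat_spec a' b'). nia.
Qed.

Lemma pair_mono_l a b a' b' : a < a' -> b <= b' -> to_nat (a, b) < to_nat (a', b').
Proof.
  intros Ha Hb. pose proof (to_nat_spec a b). pose proof (to_nat_spec a' b'). nia.
Qed.

Lemma pair_mono_r a b a' b' : a <= a' -> b < b' -> to_nat (a, b) < to_nat (a', b').
Proof.
  intros Ha Hb. pose proof (to_nat_spec a b). pose proof (to_nat_spec a' b'). nia.
Qed.

(* The even requirements decide the jump of the constructed set, the odd ones make it infinite. *)
Definition event (k f s : nat) : Prop :=
  k = 2 * (k / 2) /\ halts_within f s (k / 2) (lcons (k / 2) 0) \/
  ~ k = 2 * (k / 2) /\ bex s (fun x => k <= x /\ bit f x = true).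

Lemma event_mono k f s f' s' : s <= s' -> agree s (bit f) (bit f') ->
  event k f s -> event k f' s'.
Proof.
  intros Hs Ha [[H1 H2]|(H1 & x & Hx & H2 & H3)]; [left|right]; split; auto.
  - eapply halts_within_mono; eauto.
  - exists x. split; [lia|]. split; [assumption|]. now rewrite <- Ha.
Qed.

(* [C (x, i)] predicts the direction of the edge of the [i]-th tournament from [x] to all later
   elements. *)
Definition compat (i : nat) (C : nat -> bool) (A : nat -> Prop) : Prop :=
  (forall x y, A x -> A y -> C (to_nat (x, i)) = true -> ~ C (to_nat (y, i)) = true ->
     edge i x y) /\
  (forall x y z, A x -> A y -> A z -> edge i x y -> edge i y z -> edge i x z).

(** Each [x] in [A] relates to all of [B] as its color says. A mixed triple is transitive because
    its single edge within [A] or [B] cannot run against the colors. *)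
Lemma compat_union i C (A B : nat -> Prop) : compat i C A -> compat i C B ->
  (forall x y, A x -> B y -> x <> y /\ (edge i x y <-> C (to_nat (x, i)) = true)) ->
  compat i C (fun x => A x \/ B x).
Proof.
  intros [HA1 HA2] [HB1 HB2] HAB.
  assert (HBA : forall x y, A x -> B y -> (edge i y x <-> ~ C (to_nat (x, i)) = true)).
  { intros x y Hx Hy. destruct (HAB x y Hx Hy) as [Hne H]. rewrite <- H.
    apply edge_antisym. auto. }
  assert (Hanti : forall x y, edge i x y -> edge i y x -> False).
  { intros x y Hxy Hyx. destruct (Nat.eq_dec x y) as [->|Hne].
    - exact (edge_irrefl i y Hxy).
    - apply (edge_antisym i x y Hne) in Hxy. contradiction. }
  split.
  - intros x y [Hx|Hx] [Hy|Hy] Cx Cy; [auto| | |auto].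
    + now apply HAB.
    + now apply HBA.
  - intros x y z [Hx|Hx] [Hy|Hy] [Hz|Hz] Exy Eyz.
    + eauto.
    + apply HAB; auto. apply (HAB y z Hy Hz) in Eyz. apply NNPP. intros Cx.
      exact (Hanti x y Exy (HA1 y x Hy Hx Eyz Cx)).
    + apply (HAB x y Hx Hy) in Exy. apply (HBA z y Hz Hy) in Eyz. auto.
    + apply HAB; auto. now apply (HAB x y Hx Hy).
    + apply HBA; auto. apply (HBA y x Hy Hx) in Exy. intros Cz.
      exact (Hanti y z Eyz (HA1 z y Hz Hy Cz Exy)).
    + apply (HBA y x Hy Hx) in Exy. apply (HAB y z Hy Hz) in Eyz. contradiction.
    + apply HBA; auto. now apply (HBA z y Hz Hy).
    + eauto.
Qed.

(* A condition [h] codes the string [hF h] of length [hm h], the number [hk h] of the requirement,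
   and a string [hp h] of length [hm h] determining the reservoir. *)
Definition hF (h : nat) : nat := p1 (p1 h).
Definition hk (h : nat) : nat := p2 (p1 h).
Definition hm (h : nat) : nat := p1 (p2 h).
Definition hp (h : nat) : nat := p2 (p2 h).
Definition cond (F k m p : nat) : nat := to_nat (to_nat (F, k), to_nat (m, p)).

Lemma hF_cond F k m p : hF (cond F k m p) = F.
Proof. unfold hF, cond. now rewrite !p1_pair. Qed.
Lemma hk_cond F k m p : hk (cond F k m p) = k.
Proof. unfold hk, cond. now rewrite p1_pair, p2_pair. Qed.
Lemma hm_cond F k m p : hm (cond F k m p) = m.
Proof. unfold hm, cond. now rewrite p2_pair, p1_pair. Qed.
Lemma hp_cond F k m p : hp (cond F k m p) = p.
Proof. unfold hp, cond. now rewrite !p2_pair. Qed.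

Lemma hm_le h : hm h <= h.
Proof. unfold hm. pose proof (p1_le (p2 h)). pose proof (p2_le h). lia. Qed.
Lemma hk_le h : hk h <= h.
Proof. unfold hk. pose proof (p2_le (p1 h)). pose proof (p1_le h). lia. Qed.

Definition reservoir (h : nat) (L : nat -> bool) (x : nat) : Prop :=
  ball (hm h) (fun j => L (to_nat (j, x)) = true <-> bit (hp h) j = true).

(** [s] is both the length of the candidate string [f] and the bound on the event, so a question
    with fixed [s] is finite. *)
Definition hit_at (s h : nat) (L C : nat -> bool) (f : nat) : Prop :=
  ball (hm h) (fun j => bit (hF h) j = true <-> bit f j = true) /\
  ball s (fun x => hm h <= x -> bit f x = true -> reservoir h L x) /\
  ball (hk h) (fun i => compat i C (fun x => x < s /\ hm h <= x /\ bit f x = true)) /\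
  event (hk h) f s.

Definition hit (s h : nat) (L C : nat -> bool) : Prop := bex (2 ^ s) (hit_at s h L C).

Lemma hit_mono s s' h L C : s <= s' -> hit s h L C -> hit s' h L C.
Proof.
  intros Hs (f & Hf & H1 & H2 & H3 & H4). exists f.
  assert (Hlt : forall x, bit f x = true -> x < s).
  { intros x Hx. apply Nat.nle_gt. intros Hle. rewrite (bit_small f s) in Hx; congruence. }
  split; [pose proof (Nat.pow_le_mono_r 2 s s'); lia|].
  split; [exact H1|]. split; [|split].
  - intros x _ Hm Hx. apply H2; auto.
  - intros i Hi. destruct (H3 i Hi) as [Ha Hb]. split.
    + intros x y (_ & Hmx & Hx) (_ & Hmy & Hy). apply Ha; auto.
    + intros x y z (_ & Hmx & Hx) (_ & Hmy & Hy) (_ & Hmz & Hz). apply Hb; auto.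
  - eapply event_mono; [exact Hs| |exact H4]. intros i _. reflexivity.
Qed.

Lemma hit_at_local s h L L' C C' f :
  (forall j x, j < hm h -> x < s -> L (to_nat (j, x)) = L' (to_nat (j, x))) ->
  (forall x i, x < s -> i < hk h -> C (to_nat (x, i)) = C' (to_nat (x, i))) ->
  hit_at s h L C f -> hit_at s h L' C' f.
Proof.
  intros HL HC (H1 & H2 & H3 & H4). split; [exact H1|]. split; [|split].
  - intros x Hx Hm Hf j Hj. rewrite <- HL by assumption. now apply H2.
  - intros i Hi. destruct (H3 i Hi) as [Ha Hb]. split; [|exact Hb].
    intros x y Hx Hy. rewrite <- !HC by (try apply Hx; try apply Hy; exact Hi). auto.
  - exact H4.
Qed.

Lemma hit_local s h L L' C C' :
  (forall j x, j < hm h -> x < s -> L (to_nat (j, x)) = L' (to_nat (j, x))) ->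
  (forall x i, x < s -> i < hk h -> C (to_nat (x, i)) = C' (to_nat (x, i))) ->
  hit s h L C -> hit s h L' C'.
Proof.
  intros HL HC (f & Hf & H). exists f. split; [exact Hf|]. eapply hit_at_local; eauto.
Qed.

(** This bounds the bits of [L] read by [hit s h L (coloring L h)]: the columns below [hm h] of the
    reservoir and the columns [(2h+1, i)] of the coloring, each up to [s]. *)
Definition use (h s : nat) : nat := to_nat (to_nat (2 * h + 1, h), s).

Lemma use_reservoir h s j x : j < hm h -> x < s -> to_nat (j, x) < use h s.
Proof.
  intros Hj Hx. apply pair_mono_r; [|exact Hx].
  pose proof (hm_le h). pose proof (pair_le (2 * h + 1) h). lia.
Qed.

Lemma use_coloring h s x i : x < s -> i < hk h -> to_nat (to_nat (2 * h + 1, i), x) < use h s.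
Proof.
  intros Hx Hi. apply pair_mono_r; [|exact Hx]. apply pair_mono; [lia|].
  pose proof (hk_le h). lia.
Qed.

Lemma use_index h s x i : x < s -> i < hk h -> to_nat (x, i) < to_nat (s, h).
Proof.
  intros Hx Hi. apply pair_mono_l; [exact Hx|]. pose proof (hk_le h). lia.
Qed.

(* The sets [(2h+1, i)], [i < k], of [L] form the coloring attached to the condition [h]. *)
Definition coloring (L : nat -> bool) (h n : nat) : bool :=
  L (to_nat (to_nat (2 * h + 1, p2 n), p1 n)).

Lemma coloring_pair L h x i :
  coloring L h (to_nat (x, i)) = L (to_nat (to_nat (2 * h + 1, i), x)).
Proof. unfold coloring. now rewrite p1_pair, p2_pair. Qed.

Definition hit_at_code (s h l c f : nat) : Prop := hit_at s h (bit l) (bit c) f.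

Lemma hit_at_code_spec s h L C f :
  hit_at s h L C f <->
  hit_at_code s h (pre L (use h s)) (pre C (to_nat (s, h))) f.
Proof.
  split; apply hit_at_local.
  - intros j x Hj Hx. symmetry. apply bit_pre. now apply use_reservoir.
  - intros x i Hx Hi. symmetry. apply bit_pre. now apply use_index.
  - intros j x Hj Hx. apply bit_pre. now apply use_reservoir.
  - intros x i Hx Hi. apply bit_pre. now apply use_index.
Qed.

Lemma rec_hF X f : rec X f -> rec X (fun v => hF (f v)).
Proof. intros. unfold hF. rsolve. Qed.
Lemma rec_hk X f : rec X f -> rec X (fun v => hk (f v)).
Proof. intros. unfold hk. rsolve. Qed.
Lemma rec_hm X f : rec X f -> rec X (fun v => hm (f v)).
Proof. intros. unfold hm. rsolve. Qed.
Lemma rec_hp X f : rec X f -> rec X (fun v => hp (f v)).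
Proof. intros. unfold hp. rsolve. Qed.
Lemma rec_use X f g : rec X f -> rec X g -> rec X (fun v => use (f v) (g v)).
Proof. intros. unfold use. rsolve. Qed.
Lemma dec_event X f g h : rec X f -> rec X g -> rec X h ->
  dec X (fun v => event (f v) (g v) (h v)).
Proof. intros. unfold event. rsolve. Qed.

Ltac rec_conditions ::=
  lazymatch goal with
  | |- rec _ (fun v => hF _) => apply rec_hF
  | |- rec _ (fun v => hk _) => apply rec_hk
  | |- rec _ (fun v => hm _) => apply rec_hm
  | |- rec _ (fun v => hp _) => apply rec_hp
  | |- rec _ (fun v => use _ _) => apply rec_use
  | |- dec _ (fun v => edge _ _ _) => apply dec_edge
  | |- dec _ (fun v => event _ _ _) => apply dec_event
  end.

Lemma dec_hit_at_code X s h l c f : rec X s -> rec X h -> rec X l -> rec X c -> rec X f ->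
  dec X (fun v => hit_at_code (s v) (h v) (l v) (c v) (f v)).
Proof.
  intros Hs Hh Hl Hc Hf.
  apply dec_ext with (fun v =>
    ball (hm (h v)) (fun j => bit (hF (h v)) j = true <-> bit (f v) j = true) /\
    ball (s v) (fun x => hm (h v) <= x -> bit (f v) x = true ->
      ball (hm (h v)) (fun j =>
        bit (l v) (to_nat (j, x)) = true <-> bit (hp (h v)) j = true)) /\
    ball (hk (h v)) (fun i =>
      ball (s v) (fun x => ball (s v) (fun y =>
        hm (h v) <= x /\ bit (f v) x = true -> hm (h v) <= y /\ bit (f v) y = true ->
        bit (c v) (to_nat (x, i)) = true -> ~ bit (c v) (to_nat (y, i)) = true ->
        edge i x y)) /\
      ball (s v) (fun x => ball (s v) (fun y => ball (s v) (fun z =>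
        hm (h v) <= x /\ bit (f v) x = true -> hm (h v) <= y /\ bit (f v) y = true ->
        hm (h v) <= z /\ bit (f v) z = true ->
        edge i x y -> edge i y z -> edge i x z)))) /\
    event (hk (h v)) (f v) (s v)).
  - intros v. unfold hit_at_code, hit_at, reservoir, compat, ball.
    split; intros (H1 & H2 & H3 & H4); (split; [exact H1|]); (split; [exact H2|]);
      (split; [|exact H4]); intros i Hi; destruct (H3 i Hi) as [Ha Hb]; split; clear - Ha Hb.
    + intros x y [Hx Hx'] [Hy Hy']. auto.
    + intros x y z [Hx Hx'] [Hy Hy'] [Hz Hz']. eauto.
    + intros x Hx y Hy Hx' Hy'. apply Ha; auto.
    + intros x Hx y Hy z Hz Hx' Hy' Hz'. apply Hb; auto.
  - rsolve.
Qed.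

(** * The low set and the type *)

Lemma dec_hit_code X s h l c : rec X s -> rec X h -> rec X l -> rec X c ->
  dec X (fun v => bex (2 ^ s v) (hit_at_code (s v) (h v) (l v) (c v))).
Proof.
  intros Hs Hh Hl Hc.
  apply (dec_bex X (fun v => 2 ^ s v) (fun v => hit_at_code (s v) (h v) (l v) (c v))); rsolve.
  apply dec_hit_at_code; rsolve.
Qed.

Lemma hit_code_spec s h L C :
  hit s h L C <->
  bex (2 ^ s) (hit_at_code s h (pre L (use h s)) (pre C (to_nat (s, h)))).
Proof.
  split; intros (f & Hf & H); exists f; (split; [exact Hf|]).
  - exact (proj1 (hit_at_code_spec s h L C f) H).
  - exact (proj2 (hit_at_code_spec s h L C f) H).
Qed.

(** A coloring hit as late as possible is taken. By compactness either some coloring is never hit,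
    or there is a least bound at which all are hit, and a coloring still missed just below that
    bound will do. *)
Lemma coloring_exists h L : exists c : nat -> bool,
  forall s, hit s h L c -> forall C, hit s h L C.
Proof.
  pose (P t C := forall s, to_nat (s, h) <= t -> ~ hit s h L C).
  destruct (classic (forall t, exists C, P t C)) as [Hall|Hnot].
  - destruct (koenig P) as [c Hc].
    + intros t X Y Ha HP s Hs Hit. apply (HP s Hs). eapply hit_local; [| |exact Hit].
      * reflexivity.
      * intros x i Hx Hi. symmetry. apply Ha. pose proof (use_index h s x i Hx Hi). lia.
    + intros t X HP s Hs. apply HP. lia.
    + exact Hall.
    + exists c. intros s Hs. exfalso. exact (Hc _ s (le_n _) Hs).
  - apply not_all_ex_not in Hnot. destruct Hnot as [t Ht].
    assert (Hex : exists t, forall C, hit t h L C).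
    { exists t. intros C. apply NNPP. intros Hn. apply Ht. exists C. intros s Hs Hit.
      apply Hn. eapply hit_mono; [|exact Hit]. pose proof (pair_le s h). lia. }
    apply exists_least in Hex. destruct Hex as (t0 & Ht0 & Hlt).
    destruct t0 as [|t0].
    + exists (fun _ => false). intros s _ C. eapply hit_mono; [|apply Ht0]. lia.
    + specialize (Hlt t0 (le_n _)). apply not_all_ex_not in Hlt. destruct Hlt as [c Hc].
      exists c. intros s Hs C. eapply hit_mono; [|apply Ht0].
      apply Nat.nle_gt. intros Hle. apply Hc. eapply hit_mono; eauto.
Qed.

Definition edges_ok (L : nat -> bool) : Prop :=
  forall x i y, L (to_nat (to_nat (2 * x, i), y)) = true <-> edge i x y.

(** The same [s] on both sides makes every instance a finite check, so this is a Pi^0_1 condition on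
    [L] and the low basis theorem applies. *)
Definition colorings_ok (L : nat -> bool) : Prop :=
  forall h s, hit s h L (coloring L h) -> forall C, hit s h L C.

(** Recursion on the block number [q], the first component of a column. Block [2h+1] depends on the
    columns below [hm h], all of which lie in earlier blocks; [stage q] holds the blocks before
    [q]. *)
Lemma universal_sets_exist : exists L, edges_ok L /\ colorings_ok L.
Proof.
  pose (flat (B : nat -> nat -> nat -> bool) n := B (p1 (p1 n)) (p2 (p1 n)) (p2 n)).
  pose (good_col h L := epsilon (inhabits (fun _ : nat => false))
          (fun c => forall s, hit s h L c -> forall C, hit s h L C)).
  assert (Hgood : forall h L s, hit s h L (good_col h L) -> forall C, hit s h L C).
  { intros h L. apply (epsilon_spec (inhabits (fun _ : nat => false))
      (fun c => forall s, hit s h L c -> forall C, hit s h L C)), coloring_exists. }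
  pose (new q B := if Nat.eq_dec q (2 * (q / 2))
    then fun i y => chi (fun x => edge i x y) (q / 2)
    else fun i y => good_col (q / 2) (flat B) (to_nat (y, i))).
  pose (stage := nat_rect (fun _ => nat -> nat -> nat -> bool) (fun _ _ _ => false)
    (fun q B r => if Nat.eq_dec r q then new q B else B r)).
  pose (B q := new q (stage q)).
  assert (Hstage : forall q r, r < q -> stage q r = B r).
  { induction q as [|q IH]; intros r Hr; [lia|]. simpl. fold (stage q).
    destruct (Nat.eq_dec r q) as [->|Hne]; [reflexivity|]. apply IH. lia. }
  exists (flat B). split.
  - intros x i y. unfold flat. rewrite !p1_pair, !p2_pair. unfold B, new.
    rewrite (Nat.mul_comm 2 x), Nat.div_mul, (Nat.mul_comm 2 x) by lia.
    destruct (Nat.eq_dec (x * 2) (x * 2)); [|contradiction].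
    exact (chi_spec (fun x => edge i x y) x).
  - intros h s Hs C. set (q := 2 * h + 1).
    assert (Hq : q / 2 = h).
    { unfold q. replace (2 * h + 1) with (1 + h * 2) by lia. now rewrite Nat.div_add. }
    assert (HL : forall j x, j < hm h -> x < s ->
              flat B (to_nat (j, x)) = flat (stage q) (to_nat (j, x))).
    { intros j x Hj _. unfold flat. rewrite p1_pair, Hstage; [reflexivity|].
      pose proof (p1_le j). pose proof (hm_le h). unfold q. lia. }
    eapply (hit_local s h (flat (stage q))); [intros j x Hj Hx; symmetry; now apply HL
                                              |intros; reflexivity|].
    apply Hgood. eapply hit_local; [exact HL| |exact Hs].
    intros x i _ _. rewrite coloring_pair. unfold flat. rewrite !p1_pair, !p2_pair.
    fold q. unfold B, new. rewrite Hq.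
    destruct (Nat.eq_dec q (2 * h)); [unfold q in *; lia|]. reflexivity.
Qed.

Lemma low_universal_sets :
  exists L, edges_ok L /\ colorings_ok L /\ Turing_le (jmp L) (jmp oempty).
Proof.
  pose (idx u := to_nat (to_nat (2 * p1 (p1 u), p2 (p1 u)), p2 u)).
  (* [u] is read in two ways, as [((x, i), y)] for the edge sets and as [(h, s)] for the colorings.
     Competing colorings [C] matter only through a prefix of length [to_nat (s, h)]. *)
  pose (Bad u L :=
    ~ (L (idx u) = true <-> edge (p2 (p1 u)) (p1 (p1 u)) (p2 u)) \/
    hit (p2 u) (p1 u) L (coloring L (p1 u)) /\
    bex (2 ^ to_nat (p2 u, p1 u)) (fun t => ~ hit (p2 u) (p1 u) L (bit t))).
  pose (b u := S (idx u) + use (p1 u) (p2 u)).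
  destruct (low_basis oempty Bad b) as (L & HL & Hlow).
  - intros f Hf. unfold b, idx. rsolve.
  - intros f g Hf Hg. unfold Bad, idx.
    apply dec_ext with (fun v =>
      let s := p2 (f v) in let h := p1 (f v) in let l := pre (bit (g v)) (use h s) in
      ~ (bit (g v) (to_nat (to_nat (2 * p1 (p1 (f v)), p2 (p1 (f v))), p2 (f v))) = true <->
         edge (p2 (p1 (f v))) (p1 (p1 (f v))) (p2 (f v))) \/
      bex (2 ^ s) (hit_at_code s h l (pre (coloring (bit (g v)) h) (to_nat (s, h)))) /\
      bex (2 ^ to_nat (s, h)) (fun t =>
        ~ bex (2 ^ s) (hit_at_code s h l (pre (bit t) (to_nat (s, h)))))).
    + intros v. cbv zeta. rewrite <- hit_code_spec.
      split; (intros [H|(H1 & t & Ht & H2)]; [now left|right]); (split; [exact H1|]);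
        exists t; (split; [exact Ht|]); intros H; apply H2; now apply hit_code_spec in H.
    + cbv zeta. apply dec_or; [rsolve|]. apply dec_and.
      * apply dec_hit_code; rsolve. unfold coloring. rsolve.
      * apply dec_bex; [rsolve|]. cbv beta. apply dec_not. apply dec_hit_code; rsolve.
  - intros u X Y Ha [H|(H1 & t & Ht & H2)]; [left|right].
    + rewrite <- (Ha (idx u)); [exact H | unfold b; lia].
    + assert (Hr : forall j x, j < hm (p1 u) -> x < p2 u ->
                X (to_nat (j, x)) = Y (to_nat (j, x))).
      { intros j x Hj Hx. apply Ha. pose proof (use_reservoir _ _ _ _ Hj Hx). unfold b. lia. }
      split.
      * eapply hit_local; [exact Hr| |exact H1]. intros x i Hx Hi. rewrite !coloring_pair.
        apply Ha. pose proof (use_coloring _ _ _ _ Hx Hi). unfold b. lia.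
      * exists t. split; [exact Ht|]. intros H. apply H2.
        eapply hit_local; [| |exact H]; [|reflexivity].
        intros j x Hj Hx. symmetry. now apply Hr.
  - destruct universal_sets_exist as (L & HE & HC). exists L. intros u [H|(H1 & t & _ & H2)].
    + apply H, HE.
    + apply H2. eapply HC. exact H1.
  - exists L. split; [|split; [|exact Hlow]].
    + intros x i y. apply NNPP. intros Hn. apply (HL (to_nat (to_nat (x, i), y))). left.
      unfold idx. now rewrite !p1_pair, !p2_pair.
    + intros h s Hs C. apply NNPP. intros Hn. apply (HL (to_nat (h, s))). right.
      rewrite p1_pair, p2_pair. split; [exact Hs|].
      exists (pre C (to_nat (s, h))). split; [apply pre_lt|]. intros H. apply Hn.
      eapply hit_local; [| |exact H]; [reflexivity|].
      intros x i Hx Hi. apply bit_pre. now apply use_index.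
Qed.

Definition is_type (L p : nat -> bool) : Prop :=
  forall m n, exists y, n <= y /\ forall j, j < m -> L (to_nat (j, y)) = p j.

(** When an infinite set is split by the next column, one of the two halves is infinite; compactness
    joins the finite choices. *)
Lemma type_exists L : exists p, is_type L p.
Proof.
  apply (koenig (fun m p => forall n, exists y, n <= y /\ forall j, j < m -> L (to_nat (j, y)) = p j)).
  - intros t X Y Ha H n. destruct (H n) as (y & Hy & Hj). exists y. split; [exact Hy|].
    intros j Hlt. rewrite <- Ha by assumption. auto.
  - intros t X H n. destruct (H n) as (y & Hy & Hj). exists y. split; [exact Hy|].
    intros j Hlt. apply Hj. lia.
  - induction t as [|t [p IH]].
    + exists (fun _ => false). intros n. exists n. split; [lia|]. lia.
    + apply NNPP. intros Hn.
      assert (Hb : forall b, exists n, forall y, n <= y ->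
                (forall j, j < t -> L (to_nat (j, y)) = p j) -> L (to_nat (t, y)) <> b).
      { intros b. apply NNPP. intros Hb. apply Hn. exists (upd p t b). intros n.
        apply NNPP. intros Hy. apply Hb. exists n. intros y Hny Hj Hbt. apply Hy.
        exists y. split; [exact Hny|]. intros j Hlt. unfold upd.
        destruct (Nat.eq_dec j t) as [->|Hne]; [exact Hbt|]. apply Hj. lia. }
      destruct (Hb true) as [n1 H1], (Hb false) as [n2 H2].
      destruct (IH (n1 + n2)) as (y & Hy & Hj).
      specialize (H1 y ltac:(lia) Hj). specialize (H2 y ltac:(lia) Hj).
      destruct (L (to_nat (t, y))); congruence.
Qed.

(** [Z] joins a type, on even positions, with [jmp L], on odd ones. Coding [jmp L] into the class is
    necessary because the low basis theorem bounds the jump of [Z] without putting [jmp L] below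
    [Z]. The existence of [y] is Sigma^0_1(L), hence decided by [jmp L]. *)
Lemma low_type L : exists Z,
  Turing_le (jmp L) Z /\ is_type L (fun j => Z (2 * j)) /\ Turing_le (jmp Z) (jmp (jmp L)).
Proof.
  pose (Bad u Z :=
    ~ (Z (2 * u + 1) = true <-> jmp L u = true) \/
    ~ (exists y, u <= y /\ ball u (fun j => L (to_nat (j, y)) = true <-> Z (2 * j) = true))).
  destruct (low_basis (jmp L) Bad (fun u => 2 * u + 2)) as (Z & HZ & Hlow).
  - intros f Hf. rsolve.
  - intros f g Hf Hg. unfold Bad. rsolve.
    + apply dec_oracle. rsolve.
    + apply dec_ext with (fun v => exists y, p1 (to_nat (f v, g v)) <= y /\
        ball (p1 (to_nat (f v, g v))) (fun j => L (to_nat (j, y)) = true <->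
          bit (p2 (to_nat (f v, g v))) (2 * j) = true)).
      { intros v. now rewrite p1_pair, p2_pair. }
      apply (sigma1_dec_jmp L (fun n => exists y, p1 n <= y /\
        ball (p1 n) (fun j => L (to_nat (j, y)) = true <-> bit (p2 n) (2 * j) = true))); [|rsolve].
      exists (fun y n => p1 n <= y /\
        ball (p1 n) (fun j => L (to_nat (j, y)) = true <-> bit (p2 n) (2 * j) = true)).
      split; [|reflexivity]. rsolve. apply dec_oracle. rsolve.
  - intros u X Y Ha [H|H]; [left|right].
    + rewrite <- Ha by lia. exact H.
    + intros (y & Hy & Hj). apply H. exists y. split; [exact Hy|].
      intros j Hlt. rewrite Ha by lia. now apply Hj.
  - destruct (type_exists L) as [p Hp].
    exists (fun n => if Nat.eq_dec n (2 * (n / 2)) then p (n / 2) else jmp L (n / 2)).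
    assert (H0 : forall j, 2 * j / 2 = j) by (intros j; rewrite Nat.mul_comm; now apply Nat.div_mul).
    intros u [H|H]; apply H; clear H.
    + replace ((2 * u + 1) / 2) with u.
      * destruct (Nat.eq_dec (2 * u + 1) (2 * u)); [lia | reflexivity].
      * replace (2 * u + 1) with (1 + u * 2) by lia. now rewrite Nat.div_add.
    + destruct (Hp u u) as (y & Hy & Hj). exists y. split; [exact Hy|]. intros j Hlt.
      rewrite Hj, H0 by assumption. destruct (Nat.eq_dec (2 * j) (2 * j)); [reflexivity|contradiction].
  - exists Z. split; [|split; [|exact Hlow]].
    + apply dec_ext with (fun v => Z (2 * nth 0 v 0 + 1) = true).
      * intros v. apply NNPP. intros Hn. apply (HZ (nth 0 v 0)). now left.
      * apply dec_oracle. rsolve.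
    (* A single parameter of [Bad] governs both the number of columns and the size of [y], so
       [m + n] serves for both. *)
    + intros m n. assert (H : exists y, m + n <= y /\
        ball (m + n) (fun j => L (to_nat (j, y)) = true <-> Z (2 * j) = true)).
      { apply NNPP. intros Hn. apply (HZ (m + n)). now right. }
      destruct H as (y & Hy & Hj). exists y. split; [lia|]. intros j Hlt.
      apply eq_true_iff_eq, Hj. lia.
Qed.

(** * The construction *)

(* A number [n] codes the pair of a string [p1 n] and a length [p2 n]. *)
Definition type_coloring (p : nat -> bool) (n : nat) : bool := p (to_nat (2 * p1 n, p2 n)).
Definition state_cond (p : nat -> bool) (k n : nat) : nat :=
  cond (p1 n) k (p2 n) (pre p (p2 n)).
Definition forced (L : nat -> bool) (h : nat) : Prop := exists s, hit s h L (coloring L h).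
Definition extension (L p : nat -> bool) (h n : nat) : Prop :=
  p1 n < 2 ^ p2 n /\ hit_at (p2 n) h L (type_coloring p) (p1 n).
(** This length exceeds the columns [(2x, i)] of edges from every [x < s] and the coloring columns
    [(2h+1, i)], for all [i < k]. The next reservoir thus fixes these edge directions and makes the
    attached coloring constant. *)
Definition bound (s h k : nat) : nat := to_nat (2 * (s + h) + 1, k).
(** The disjunct [~ forced L h] keeps the search total. *)
Definition best_ext (L p : nat -> bool) (h : nat) : nat :=
  least (fun n => ~ forced L h \/ extension L p h n).
(** The reservoir is thinned in both cases, simply by lengthening the prefix of [p]; the skipped
    positions become zeros of the string. *)
Definition next (L p : nat -> bool) (k n : nat) : nat :=
  let h := state_cond p k n in
  ite (forced L h)
    (to_nat (p1 (best_ext L p h), bound (p2 (best_ext L p h)) h k))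
    (to_nat (p1 n, bound (p2 n) h k)).
Definition run (L p : nat -> bool) (k : nat) : nat :=
  nat_rect (fun _ => nat) (to_nat (0, 0)) (next L p) k.
Definition run_cond (L p : nat -> bool) (k : nat) : nat := state_cond p k (run L p k).
Definition run_set (L p : nat -> bool) (x : nat) : Prop :=
  exists k, bit (p1 (run L p k)) x = true.

(** A hit for the attached coloring gives one for every coloring, in particular for
    [type_coloring p]. As column [(2x, i)] consists of the out-neighbours of [x], the latter is the
    coloring by limit directions along the type. *)
Lemma extension_exists L p h : colorings_ok L ->
  exists n, ~ forced L h \/ extension L p h n.
Proof.
  intros HL. destruct (classic (forced L h)) as [[s Hs]|Hn].
  - destruct (HL h s Hs (type_coloring p)) as (f & Hf & H).
    exists (to_nat (f, s)). right. unfold extension. rewrite p1_pair, p2_pair. auto.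
  - exists 0. now left.
Qed.

(** Since only the attached coloring is consulted, being forced is Sigma^0_1(L), without a
    quantifier over colorings. *)
Lemma dec_forced L Z f : Turing_le (jmp L) Z -> rec Z f -> dec Z (fun v => forced L (f v)).
Proof.
  intros HZ Hf.
  apply (dec_app1 Z (forced L)); [|exact Hf]. apply (dec_Turing_le (jmp L)); [exact HZ|].
  apply (sigma1_dec_jmp L (forced L)); [|apply rec_nth].
  exists (fun s h => hit s h L (coloring L h)). split; [|reflexivity].
  eapply dec_ext; [intros v; symmetry; apply hit_code_spec|].
  apply dec_hit_code; rsolve.
  - apply dec_oracle. rsolve.
  - unfold coloring. apply dec_oracle. rsolve.
Qed.

Lemma rec_run L p Z f : colorings_ok L -> Turing_le (jmp L) Z ->
  dec Z (fun v => p (nth 0 v 0) = true) -> rec Z f ->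
  rec Z (fun v => run_cond L p (f v)).
Proof.
  intros HL HZ Hp Hf.
  assert (HLZ : Turing_le L Z) by (eapply Turing_le_trans; [apply Turing_le_jmp | exact HZ]).
  assert (Hpf : forall g, rec Z g -> dec Z (fun v => p (g v) = true)).
  { intros g. apply (dec_app1 Z (fun n => p n = true)). exact Hp. }
  assert (Hcond : forall g h, rec Z g -> rec Z h -> rec Z (fun v => state_cond p (g v) (h v))).
  { intros g h Hg Hh. unfold state_cond, cond. rsolve. }
  assert (Hbest : forall g, rec Z g -> rec Z (fun v => best_ext L p (g v))).
  { intros g Hg. unfold best_ext.
    apply (rec_mu Z (fun v n => ~ forced L (g v) \/ extension L p (g v) n)).
    - apply dec_or; [apply dec_not; apply dec_forced; rsolve|].
      unfold extension. apply dec_and; [rsolve|].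
      eapply dec_ext; [intros v; symmetry; apply hit_at_code_spec|].
      apply dec_hit_at_code; rsolve.
      unfold type_coloring. apply Hpf. rsolve.
    - intros v. now apply extension_exists. }
  unfold run_cond. apply Hcond; [exact Hf|]. unfold run.
  apply (rec_nat_rect Z (fun _ => to_nat (0, 0)) f (fun _ => next L p)); [rsolve|exact Hf|].
  unfold next, bound.
  apply rec_ite; [apply dec_forced; [exact HZ | apply Hcond; rsolve] | |];
    rsolve; try apply Hbest; try apply Hcond; rsolve.
Qed.

(** * Verification of the construction *)

Section Run.
Variables L p : nat -> bool.
Hypothesis Hedge : edges_ok L.
Hypothesis Hcol : colorings_ok L.
Hypothesis Htype : is_type L p.

Let F k := p1 (run L p k).
Let M k := p2 (run L p k).
Let H k := run_cond L p k.

Lemma run_cond_parts k : hF (H k) = F k /\ hk (H k) = k /\ hm (H k) = M k /\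
  hp (H k) = pre p (M k).
Proof.
  unfold H, run_cond, state_cond. now rewrite hF_cond, hk_cond, hm_cond, hp_cond.
Qed.

Lemma run_step k :
  (forced L (H k) /\ exists s, F (S k) < 2 ^ s /\
     hit_at s (H k) L (type_coloring p) (F (S k)) /\ M (S k) = bound s (H k) k) \/
  (~ forced L (H k) /\ F (S k) = F k /\ M (S k) = bound (M k) (H k) k).
Proof.
  unfold F, M. cbn [run nat_rect]. fold (run L p k). unfold next.
  change (state_cond p k (run L p k)) with (H k).
  destruct (classic (forced L (H k))) as [Hy|Hn].
  - left. split; [exact Hy|]. rewrite ite_true by exact Hy.
    destruct (least_spec _ (extension_exists L p (H k) Hcol)) as [Hn|[H1 H2]]; [contradiction|].
    fold (best_ext L p (H k)) in H1, H2.
    exists (p2 (best_ext L p (H k))). rewrite p1_pair, p2_pair. auto.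
  - right. split; [exact Hn|]. rewrite ite_false by exact Hn.
    now rewrite p1_pair, p2_pair.
Qed.

Lemma bound_ge s h k : s <= bound s h k /\ h <= bound s h k.
Proof. unfold bound. pose proof (pair_le (2 * (s + h) + 1) k). lia. Qed.

Lemma run_len_cond k : M k <= H k.
Proof. destruct (run_cond_parts k) as (_ & _ & <- & _). apply hm_le. Qed.

Lemma run_len_S k : M k <= M (S k).
Proof.
  pose proof (run_len_cond k).
  destruct (run_step k) as [(_ & s & _ & _ & ->)|(_ & _ & ->)].
  - pose proof (bound_ge s (H k) k). lia.
  - pose proof (bound_ge (M k) (H k) k). lia.
Qed.

Lemma run_len_mono k k' : k <= k' -> M k <= M k'.
Proof. induction 1; [lia|]. pose proof (run_len_S m). lia. Qed.

Lemma run_lt k : F k < 2 ^ M k.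
Proof.
  induction k as [|k IH].
  - unfold F, M. cbn [run nat_rect]. rewrite p1_pair, p2_pair. simpl. lia.
  - destruct (run_step k) as [(_ & s & Hs & _ & HM)|(_ & HF & HM)]; rewrite HM.
    + pose proof (bound_ge s (H k) k). pose proof (Nat.pow_le_mono_r 2 s (bound s (H k) k)). lia.
    + rewrite HF. pose proof (bound_ge (M k) (H k) k).
      pose proof (Nat.pow_le_mono_r 2 (M k) (bound (M k) (H k) k)). lia.
Qed.

Lemma run_elem_lt k x : bit (F k) x = true -> x < M k.
Proof.
  intros Hx. apply Nat.nle_gt. intros Hle.
  rewrite (bit_small _ (M k)) in Hx; [discriminate | apply run_lt | exact Hle].
Qed.

Lemma run_agree_S k : agree (M k) (bit (F k)) (bit (F (S k))).
Proof.
  destruct (run_step k) as [(_ & s & _ & (H1 & _) & _)|(_ & -> & _)]; [|intros i _; reflexivity].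
  destruct (run_cond_parts k) as (EF & _ & Em & _). rewrite EF, Em in H1.
  intros i Hi. apply eq_true_iff_eq. now apply H1.
Qed.

Lemma run_elem_mono k k' x : k <= k' -> bit (F k) x = true -> bit (F k') x = true.
Proof.
  intros Hk Hx. induction Hk as [|k' Hk IH]; [exact Hx|].
  rewrite <- run_agree_S; [exact IH|]. now apply run_elem_lt.
Qed.

Lemma run_set_iff k x : x < M k -> (run_set L p x <-> bit (F k) x = true).
Proof.
  intros Hx. split; [|intros Hb; now exists k].
  intros [k' Hb]. fold (F k') in Hb. destruct (Nat.le_gt_cases k' k) as [Hle|Hlt].
  - eapply run_elem_mono; eauto.
  - assert (Hag : agree (M k) (bit (F k)) (bit (F k'))).
    { clear Hb Hx. apply Nat.lt_le_incl in Hlt. induction Hlt as [|k' Hlt IH]; [intros i _; reflexivity|].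
      eapply agree_trans; [exact IH|]. eapply agree_le; [|apply run_agree_S].
      now apply run_len_mono. }
    now rewrite Hag.
Qed.

Lemma run_new_elem k x : bit (F (S k)) x = true -> M k <= x ->
  exists s, x < s /\ forced L (H k) /\ hit_at s (H k) L (type_coloring p) (F (S k)) /\
    M (S k) = bound s (H k) k /\ forall j, j < M k -> L (to_nat (j, x)) = p j.
Proof.
  intros Hx Hm. destruct (run_step k) as [(Hy & s & Hs & Hhit & HM)|(_ & HF & _)].
  - exists s. assert (Hxs : x < s).
    { apply Nat.nle_gt. intros Hle. rewrite (bit_small _ s) in Hx; congruence. }
    do 4 (split; [assumption|]). destruct Hhit as (_ & H2 & _). intros j Hj.
    destruct (run_cond_parts k) as (_ & _ & Em & Ep).
    specialize (H2 x Hxs). rewrite Em in H2. specialize (H2 Hm Hx j).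
    rewrite Em, Ep, bit_pre in H2 by assumption. apply eq_true_iff_eq. auto.
  - rewrite HF in Hx. apply run_elem_lt in Hx. lia.
Qed.

(** An element enters through some later reservoir, and these shrink as the lengths grow. *)
Lemma run_set_reservoir k x : run_set L p x -> M k <= x ->
  forall j, j < M k -> L (to_nat (j, x)) = p j.
Proof.
  intros [k' Hx] Hm. fold (F k') in Hx. induction k' as [|k' IH].
  - unfold F in Hx. cbn [run nat_rect] in Hx. rewrite p1_pair, bit_0 in Hx. discriminate.
  - destruct (Nat.le_gt_cases (M k') x) as [Hle|Hlt].
    + destruct (run_new_elem k' x Hx Hle) as (s & _ & _ & _ & _ & Hj).
      intros j Hjk. apply Hj. apply run_elem_lt in Hx.
      destruct (Nat.le_gt_cases k k') as [Hk|Hk].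
      * pose proof (run_len_mono k k' Hk). lia.
      * pose proof (run_len_mono (S k') k Hk). lia.
    + apply IH. rewrite run_agree_S by assumption. exact Hx.
Qed.

(** The column of edges from [x] is already among those the current reservoir fixes, so all elements
    added later lie on the side of [x] prescribed by [p]. *)
Lemma run_index k0 i x k : i < k0 -> k0 <= k -> M k0 <= x -> bit (F k) x = true ->
  to_nat (2 * x, i) < M k.
Proof.
  intros Hi Hk Hm. induction Hk as [|k Hk IH].
  - intros Hx. apply run_elem_lt in Hx. lia.
  - intros Hx. destruct (Nat.le_gt_cases (M k) x) as [Hle|Hlt].
    + destruct (run_new_elem k x Hx Hle) as (s & Hs & _ & _ & -> & _).
      unfold bound. apply pair_mono_r; lia.
    + pose proof (run_len_S k). rewrite <- run_agree_S in Hx by assumption. specialize (IH Hx). lia.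
Qed.

(** Induction on [k]: the newly added block is compatible by the hit, and its edges to the older
    elements follow the type, so [compat_union] applies. Elements below [M k0] are left out because
    the [i]-th tournament was ignored when they were chosen. *)
Lemma run_compat k0 i k : i < k0 -> k0 <= k ->
  compat i (type_coloring p) (fun x => M k0 <= x /\ bit (F k) x = true).
Proof.
  intros Hi Hk.
  assert (Hext : forall A B : nat -> Prop, (forall x, B x -> A x) ->
            compat i (type_coloring p) A -> compat i (type_coloring p) B).
  { intros A B HBA [Ha Hb]. split; [auto|eauto]. }
  induction Hk as [|k Hk IH].
  - apply (Hext (fun _ => False)); [|split; tauto].
    intros x [Hm Hx]. apply run_elem_lt in Hx. lia.
  - pose proof (run_len_mono k0 k Hk) as Hmono.
    apply (Hext (fun x => (M k0 <= x /\ bit (F k) x = true) \/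
                          (M k <= x /\ bit (F (S k)) x = true))).
    { intros x [Hm Hx]. destruct (Nat.le_gt_cases (M k) x) as [Hle|Hlt]; [auto|].
      left. rewrite run_agree_S by assumption. auto. }
    apply compat_union; [exact IH| |].
    + destruct (run_step k) as [(_ & s & Hs & (_ & _ & H3 & _) & _)|(_ & HF & _)].
      * destruct (run_cond_parts k) as (_ & Ek & Em & _). rewrite Ek, Em in H3.
        apply (Hext _ _) with (2 := H3 i ltac:(lia)). intros x [Hm Hx].
        split; [|auto]. apply Nat.nle_gt. intros Hle.
        rewrite (bit_small _ s) in Hx; congruence.
      * apply (Hext (fun _ => False)); [|split; tauto].
        intros x [Hm Hx]. rewrite HF in Hx. apply run_elem_lt in Hx. lia.
    + intros x y [Hmx Hx] [Hmy Hy]. pose proof (run_elem_lt k x Hx) as Hlt.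
      split; [lia|]. rewrite <- (Hedge x i y).
      destruct (run_new_elem k y Hy Hmy) as (_ & _ & _ & _ & _ & Hj).
      rewrite Hj by (eapply run_index; eauto).
      unfold type_coloring. rewrite p1_pair, p2_pair. reflexivity.
Qed.

Lemma run_set_transitive i x y z : M (S i) <= x -> M (S i) <= y -> M (S i) <= z ->
  run_set L p x -> run_set L p y -> run_set L p z -> edge i x y -> edge i y z -> edge i x z.
Proof.
  intros Hx Hy Hz [kx Bx] [ky By] [kz Bz].
  pose (K := S i + kx + ky + kz).
  destruct (run_compat (S i) i K) as [_ Htr]; [lia|unfold K; lia|].
  apply Htr; (split; [assumption|]).
  - apply (run_elem_mono kx); [unfold K; lia | exact Bx].
  - apply (run_elem_mono ky); [unfold K; lia | exact By].
  - apply (run_elem_mono kz); [unfold K; lia | exact Bz].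
Qed.

Lemma forced_event k : forced L (H k) ->
  exists s, event k (pre (chi (run_set L p)) s) s.
Proof.
  intros Hy. destruct (run_step k) as [(_ & s & _ & (_ & _ & _ & He) & HM)|(Hn & _)]; [|contradiction].
  destruct (run_cond_parts k) as (_ & Ek & _). rewrite Ek in He. exists s.
  eapply event_mono; [apply le_n| |exact He]. intros x Hx. rewrite bit_pre by assumption.
  apply eq_true_iff_eq. rewrite chi_spec. symmetry. apply run_set_iff.
  rewrite HM. pose proof (bound_ge s (H k) k). lia.
Qed.

(** If the answer had been negative, the thinned reservoir would make the attached coloring constant
    on the rest of G. The initial segment of G realising the event would then itself be a hit for
    that coloring. *)
Lemma event_forced k s : event k (pre (chi (run_set L p)) s) s -> forced L (H k).
Proof.
  intros He. apply NNPP. intros Hn.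
  destruct (run_step k) as [(Hy & _)|(_ & HF & HM)]; [contradiction|].
  (* Adding [M k] makes the segment long enough to contain the string of the condition. *)
  apply Hn. exists (s + M k). exists (pre (chi (run_set L p)) (s + M k)).
  split; [apply pre_lt|]. destruct (run_cond_parts k) as (EF & Ek & Em & Ep).
  assert (Hin : forall x, bit (pre (chi (run_set L p)) (s + M k)) x = true -> run_set L p x).
  { intros x Hx. destruct (Nat.le_gt_cases (s + M k) x) as [Hle|Hlt].
    - rewrite (bit_small _ (s + M k)) in Hx by auto using pre_lt. discriminate.
    - rewrite bit_pre in Hx by assumption. now apply chi_spec. }
  unfold hit_at. rewrite EF, Ek, Em. split; [|split; [|split]].
  - intros x Hx. rewrite bit_pre by lia. rewrite chi_spec. symmetry. now apply run_set_iff.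
  - intros x _ Hx Hb. unfold reservoir. rewrite Em, Ep. intros j Hj.
    rewrite bit_pre by assumption. rewrite (run_set_reservoir k x); auto. reflexivity.
  - intros i Hi.
    (* A negative answer adds no elements, so those from [M k] on are at least [M (S k)] and lie in
       the thinned reservoir. With a constant color the first clause of [compat] is vacuous. *)
    assert (Hconst : forall x, M k <= x -> run_set L p x ->
              coloring L (H k) (to_nat (x, i)) = p (to_nat (2 * H k + 1, i))).
    { intros x Hx Hr. rewrite coloring_pair. apply (run_set_reservoir (S k)); [exact Hr| |].
      - apply Nat.nlt_ge. intros Hlt. apply (run_set_iff (S k)) in Hr; [|exact Hlt].
        rewrite HF in Hr. apply run_elem_lt in Hr. lia.
      - rewrite HM. unfold bound. apply pair_mono_r; lia. }
    split.
    + intros x y (_ & Hmx & Hx) (_ & Hmy & Hy). rewrite !Hconst by auto. tauto.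
    + intros x y z (_ & Hmx & Hx) (_ & Hmy & Hy) (_ & Hmz & Hz).
      assert (Hmi : M (S i) <= M k) by (apply run_len_mono; exact Hi).
      apply run_set_transitive; auto; lia.
  - eapply event_mono; [| |exact He]; [lia|]. intros x Hx. now rewrite !bit_pre by lia.
Qed.

(** A single new element of the reservoir suffices: a one-element set is compatible with every
    coloring, and the type keeps the reservoir infinite. *)
Lemma odd_forced k : k <> 2 * (k / 2) -> forced L (H k).
Proof.
  intros Hodd. destruct (Htype (M k) (M k + k)) as (x & Hx & Hj).
  destruct (run_cond_parts k) as (EF & Ek & Em & Ep).
  exists (S x), (F k + 2 ^ x).
  assert (HFx : F k < 2 ^ x).
  { pose proof (run_lt k). pose proof (Nat.pow_le_mono_r 2 (M k) x). lia. }
  split; [simpl; lia|].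
  assert (Honly : forall y, M k <= y -> y < S x -> bit (F k + 2 ^ x) y = true -> y = x).
  { intros y Hy Hyx Hb. destruct (Nat.eq_dec y x) as [|Hne]; [assumption|].
    rewrite bit_add_pow_lt in Hb by lia. apply run_elem_lt in Hb. lia. }
  unfold hit_at. rewrite EF, Ek, Em. split; [|split; [|split]].
  - intros y Hy. now rewrite bit_add_pow_lt by lia.
  - intros y Hyx Hy Hb. rewrite (Honly y Hy Hyx Hb). unfold reservoir. rewrite Em, Ep.
    intros j Hlt. rewrite bit_pre, Hj by assumption. reflexivity.
  - intros i Hi. split.
    + intros y z (Hy1 & Hy2 & Hy3) (Hz1 & Hz2 & Hz3).
      rewrite (Honly y), (Honly z) by auto. tauto.
    + intros y z w (Hy1 & Hy2 & Hy3) (Hz1 & Hz2 & Hz3) _.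
      rewrite (Honly y), (Honly z) by auto. intros E. now apply edge_irrefl in E.
  - right. split; [exact Hodd|]. exists x. split; [lia|]. split; [lia|].
    now apply bit_add_pow_eq.
Qed.

Lemma run_set_infinite : infinite (run_set L p).
Proof.
  intros n. destruct (forced_event (2 * n + 1)) as [s Hs].
  - apply odd_forced. replace (2 * n + 1) with (1 + n * 2) by lia.
    rewrite Nat.div_add by lia. simpl (1 / 2). lia.
  - destruct Hs as [[He _]|(_ & x & Hx & Hn & Hb)].
    + lia.
    + exists x. split; [lia|]. rewrite bit_pre in Hb by assumption. now apply chi_spec.
Qed.

(** The answer given to requirement [2 * e] is final in both directions, so the construction itself
    decides the jump. *)
Lemma run_set_halts e : halts (chi (run_set L p)) e e <-> forced L (H (2 * e)).
Proof.
  assert (Hd : 2 * e / 2 = e) by (rewrite Nat.mul_comm; now apply Nat.div_mul).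
  rewrite halts_within_spec. split.
  - intros [s Hs]. apply (event_forced (2 * e) s). left. now rewrite Hd.
  - intros Hf. apply forced_event in Hf. destruct Hf as [s [[_ Hs]|[Hne _]]].
    + exists s. now rewrite Hd in Hs.
    + lia.
Qed.

End Run.

Theorem theorem5 :
  exists G : nat -> Prop,
    Turing_red (jump (jump G)) (jump (jump empty_set)) /\
    forall (D : nat -> Prop) (T : nat -> nat -> Prop),
      infinite D -> tournament D T -> computable D -> computable2 T ->
      exists H : nat -> Prop,
        transitive_subset D T H /\ infinite H /\ Turing_red H G.
Proof.
  destruct low_universal_sets as (L & Hedge & Hcol & Hlow).
  destruct (low_type L) as (Z & HLZ & Htype & HZ).
  set (p := fun j => Z (2 * j)) in *.
  exists (run_set L p). split.
  - assert (Hjump : Turing_le (jmp (chi (run_set L p))) Z).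
    { apply dec_ext with (fun v => forced L (run_cond L p (2 * nth 0 v 0))).
      - intros v. unfold jmp. rewrite chi_spec. symmetry. now apply run_set_halts.
      - apply dec_forced; [exact HLZ|]. apply rec_run; auto.
        + unfold p. apply dec_oracle. rsolve.
        + rsolve. }
    apply Turing_red_iff. rewrite !chi_jump.
    replace (chi empty_set) with oempty.
    + apply dec_ext with (fun v => jmp (jmp (chi (run_set L p))) (nth 0 v 0) = true).
      * intros v. rewrite <- !chi_jump. apply chi_spec.
      * apply (Turing_le_trans _ (jmp Z)); [now apply jmp_mono|].
        apply (Turing_le_trans _ (jmp (jmp L))); [exact HZ | now apply jmp_mono].
    + apply is_char_chi. intros n. unfold oempty, empty_set. split; [discriminate | tauto].
  - intros D T HinfD HT HcD HcT.
    apply (transitive_subset_of_eventually_transitive _ D T); auto.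
    + now apply run_set_infinite.
    (* The [i]-th tournament is taken into account from requirement [S i] on, so transitivity holds
       beyond the length reached there. *)
    + intros i. exists (p2 (run L p (S i))). intros x y z. now apply run_set_transitive.
Qed.
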